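(* The linear subspace of $H^{ev}(X,\mathbb C)$ spanned by $\{\ell_T:T\in\mathcal T_K\}$ is of the form $B\otimes_{\mathbb Q}\mathbb C$, where $B\subset H^{ev}(X,\mathbb Q)$ is a rational subspace.
   Context: $K$ is a CM-field, $F$ its maximal totally real subfield, $\iota$ the generator of $\mathrm{Gal}(K/F)$, $e=[K:\mathbb Q]$, $\Sigma$ the set of embeddings $K\to\mathbb C$, $\hat\Sigma$ the set of embeddings $F\to\mathbb R$. A CM-type is a map $T:\hat\Sigma\to\Sigma$ with $T(\hat\sigma)|_F=\hat\sigma$; $\mathcal T_K$ is the set of all $2^{e/2}$ CM-types. $d$ is a positive even integer, $X$ is a complex abelian variety of dimension $n=de/4$ with an algebra embedding $\hat\eta:F\to\mathrm{End}_{\mathbb Q}(X)$, so $\dim_FH^1(X,\mathbb Q)=d$; $\hat X$ is the dual abelian variety. $V=H^1(X,\mathbb Z)\oplus H^1(\hat X,\mathbb Z)$, with $H^1(\hat X,\mathbb Z)=H^1(X,\mathbb Z)^*$ and pairing $((w_1,\theta_1),(w_2,\theta_2))_V=\theta_1(w_2)+\theta_2(w_1)$; $V_L=V\otimes_{\mathbb Z}L$. $F$ acts on $V_{\mathbb Q}$ via $\hat\eta$, acting on $H^1(\hat X,\mathbb Q)$ by $\theta\mapsto\theta\circ\hat\eta(a)$; $(\cdot,\cdot)_{V_{\hat\eta}}$ is the unique $F$-valued symmetric $F$-bilinear form on $V_{\mathbb Q}$ with $\mathrm{tr}_{F/\mathbb Q}\circ(\cdot,\cdot)_{V_{\hat\eta}}=(\cdot,\cdot)_V$.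 $\iota$ acts on $V_{\mathbb Q}\otimes_FK$ through the second factor. $W=\rho_{g_0}(H^1(\hat X,\mathbb Q)\otimes_FK)$ for some $g_0$ in the spin group of $V_{\mathbb Q}\otimes_FK$ (with the $K$-bilinear extension of $(\cdot,\cdot)_{V_{\hat\eta}}$; $\rho$ is the vector representation), and it is assumed that $W\cap\iota(W)=0$. Then $V_{\mathbb Q}=\{w+\iota(w):w\in W\}$, and $\eta:K\to\mathrm{End}_{\mathbb Q}(V_{\mathbb Q})$ is $\eta(t)(w+\iota(w))=tw+\iota(tw)$. $V_{\sigma,\mathbb C}\subset V_{\mathbb C}$ is the subspace on which $\eta(t)$ acts by $\sigma(t)$ for all $t\in K$; $W_{T,\mathbb C}=\bigoplus_{\hat\sigma\in\hat\Sigma}V_{T(\hat\sigma),\mathbb C}$, a maximal isotropic subspace of $V_{\mathbb C}$. $V_{\mathbb C}$ acts on $H^*(X,\mathbb C)$ by $(w,\theta)\cdot s=w\wedge s+\theta\rfloor s$; $\ell_T\subset H^{ev}(X,\mathbb C)$ is the one-dimensional subspace spanned by a pure spinor of $W_{T,\mathbb C}$, i.e. the line of all $s$ with $v\cdot s=0$ for all $v\in W_{T,\mathbb C}$. *)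

(* Defs.v *)
From HB Require Import structures.
From mathcomp Require Import all_boot all_order all_algebra all_field.
From mathcomp Require Import boolp classical_sets reals.
From mathcomp Require Import complex.

Set Implicit Arguments.
Unset Strict Implicit.
Unset Printing Implicit Defensive.
Import GRing.Theory Num.Theory.
Local Open Scope classical_set_scope.
Local Open Scope ring_scope.

Definition lin_span (L : fieldType) (M : lmodType L) (A : set M) : set M :=
  [set v | exists k (c : 'I_k -> L) (x : 'I_k -> M),
     (forall i, A (x i)) /\ v = \sum_i c i *: x i].

Definition totally_real (R : realType) (L : fieldExtType rat) : Prop :=
  forall (s : {rmorphism L -> R[i]}) (x : L), complex.Im (s x) = 0.

Definition totally_imaginary (R : realType) (L : fieldExtType rat) : Prop :=
  forall s : {rmorphism L -> R[i]}, exists x : L, complex.Im (s x) != 0.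

Definition CM_field (R : realType) (K : fieldExtType rat) : Prop :=
  totally_imaginary R K /\
  exists F : {subfield K}, totally_real R (subvs_of F) /\ \dim_F {:K} = 2%N.

Definition max_totally_real (R : realType) (K : fieldExtType rat)
    (F : {subfield K}) : Prop :=
  totally_real R (subvs_of F) /\
  forall F' : {subfield K}, totally_real R (subvs_of F') -> (F' <= F)%VS.

(* For [K : F] = 2 the group Gal(K/F) has order 2, so its generator is its
   only nontrivial element. *)
Definition Gal_generator (K : fieldExtType rat) (F : {subfield K})
    (iota : {rmorphism K -> K}) : Prop :=
  (forall a, a \in F -> iota a = a) /\ (exists x, iota x != x).

Definition field_trace (L : fieldExtType rat) (a : L) : rat :=
  \sum_(k < \dim {:L}) coord (vbasis {:L}) k (a * (vbasis {:L})`_k).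

Definition CM_type (R : realType) (K : fieldExtType rat) (F : {subfield K})
    (T : {rmorphism subvs_of F -> R} -> {rmorphism K -> R[i]}) : Prop :=
  forall (s : {rmorphism subvs_of F -> R}) (a : subvs_of F),
    T s (vsval a) = (s a)%:C%C.

(* X = C^n / Lambda, where Lambda = H_1(X, Z) is the lattice spanned by the
   columns of the period matrix.  Coordinates on Lambda identify H_1(X, L)
   with column vectors of length 2n and H^1(X, L) with row vectors.  If
   period *m x' = 'i *: (period *m x), then x' is the image of x under the
   complex structure of Lambda (x) R, so [polarized] asks for an integral
   alternating form E with E('i x, 'i y) = E(x, y) and E('i x, x) > 0. *)
Record abelian_variety (R : realType) (n : nat) := AbelianVariety {
  period : 'M[R[i]]_(n, n.*2);
  period_free : forall x : 'cV[R]_(n.*2),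
    period *m map_mx (real_complex R) x = 0 -> x = 0;
  polarized : exists E : 'M[int]_(n.*2),
    let ER := map_mx intr E : 'M[R]_(n.*2) in
    let timesI (x x' : 'cV[R]_(n.*2)) :=
      period *m map_mx (real_complex R) x' =
      'i%C *: (period *m map_mx (real_complex R) x) in
    [/\ E^T = - E,
        forall x x' y y', timesI x x' -> timesI y y' ->
          x'^T *m ER *m y' = x^T *m ER *m y
      & forall x x', timesI x x' -> x != 0 -> 0 < (x'^T *m ER *m x) 0 0] }.

(* M, acting on H_1(X, Q) by x |-> M *m x, is the rational representation of an
   element of End_Q(X). *)
Definition End_Q (R : realType) (n : nat) (X : abelian_variety R n) :
    set 'M[rat]_(n.*2) :=
  [set M | exists A : 'M[R[i]]_n, A *m period X = period X *m map_mx ratr M].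

(* V_L = H^1(X, L) (+) H^1(X, L)^* with m = 2n: v : 'rV_(m + m) is the pair
   (w, theta) with w = lsubmx v and theta = rsubmx v, where theta is written in
   the basis dual to that of H^1(X, Z), so that theta(w) = theta *m w^T. *)
Definition pairing_V (L : fieldType) (m : nat) (v1 v2 : 'rV[L]_(m + m)) : L :=
  (rsubmx v1 *m (lsubmx v2)^T + rsubmx v2 *m (lsubmx v1)^T) 0 0.

(* M acts on H_1(X, Q) by x |-> M *m x, hence on H^1(X, Q) by pullback
   w |-> w *m M and on H^1(X, Q)^* by precomposition with that pullback. *)
Definition act_V (m : nat) (M : 'M[rat]_m) (v : 'rV[rat]_(m + m)) :
    'rV[rat]_(m + m) :=
  row_mx (lsubmx v *m M) (rsubmx v *m M^T).

Definition is_F_pairing (K : fieldExtType rat) (F : {subfield K}) (m : nat)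
    (act : subvs_of F -> 'rV[rat]_(m + m) -> 'rV[rat]_(m + m))
    (bF : 'rV[rat]_(m + m) -> 'rV[rat]_(m + m) -> subvs_of F) : Prop :=
  [/\ forall u v, bF u v = bF v u,
      forall u v w, bF (u + v) w = bF u w + bF v w,
      forall a u v, bF (act a u) v = a * bF u v
    & forall u v, field_trace (bF u v) = pairing_V u v].

(* The universal property of j = (v |-> v (x) 1) : V -> VK = V (x)_F K. *)
Definition is_scalar_extension (K : fieldExtType rat) (F : {subfield K})
    (V : zmodType) (act : subvs_of F -> V -> V)
    (VK : lmodType K) (j : {additive V -> VK}) : Prop :=
  (forall a v, j (act a v) = vsval a *: j v) /\
  forall (M : lmodType K) (f : {additive V -> M}),
    (forall a v, f (act a v) = vsval a *: f v) ->
    exists g : {linear VK -> M}, (forall v, g (j v) = f v) /\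
      forall h : {linear VK -> M}, (forall v, h (j v) = f v) -> h =1 g.

Definition is_K_pairing (K : fieldExtType rat) (F : {subfield K})
    (V : zmodType) (bF : V -> V -> subvs_of F)
    (VK : lmodType K) (j : {additive V -> VK}) (bK : VK -> VK -> K) : Prop :=
  [/\ forall x y z, bK (x + y) z = bK x z + bK y z,
      forall x y z, bK z (x + y) = bK z x + bK z y,
      forall t x y, bK (t *: x) y = t * bK x y,
      forall t x y, bK x (t *: y) = t * bK x y
    & forall u v, bK (j u) (j v) = vsval (bF u v)].

(* These conditions determine iV, since VK is K-spanned by the image of j. *)
Definition is_second_factor_action (K : fieldExtType rat)
    (iota : {rmorphism K -> K}) (V : zmodType) (VK : lmodType K)
    (j : {additive V -> VK}) (iV : {additive VK -> VK}) : Prop :=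
  (forall t x, iV (t *: x) = iota t *: iV x) /\ (forall v, iV (j v) = j v).

(* H^1(X^, Q) (x)_F K as a K-subspace of V_Q (x)_F K. *)
Definition H1dual_K (K : fieldExtType rat) (m : nat) (VK : lmodType K)
    (j : {additive 'rV[rat]_(m + m) -> VK}) : set VK :=
  lin_span [set j (row_mx 0 theta) | theta in [set: 'rV[rat]_m]].

(* Normalised by v . v = (v, v) / 2, i.e. v1 . v2 + v2 . v1 = (v1, v2). *)
Definition is_Clifford_algebra (K : fieldType) (V : lmodType K)
    (b : V -> V -> K) (A : algType K) (c : {linear V -> A}) : Prop :=
  (forall v, c v * c v = (b v v / 2%:R)%:A) /\
  forall (B : algType K) (f : {linear V -> B}),
    (forall v, f v * f v = (b v v / 2%:R)%:A) ->
    exists g : {lrmorphism A -> B}, (forall v, g (c v) = f v) /\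
      forall h : {lrmorphism A -> B}, (forall v, h (c v) = f v) -> h =1 g.

Definition Clifford_even (K : fieldType) (V : lmodType K) (A : algType K)
    (c : {linear V -> A}) : set A :=
  lin_span [set x | exists s : seq V,
                      ~~ odd (size s) /\ x = \prod_(v <- s) c v].

(* The main anti-involution v1 ... vk |-> vk ... v1. *)
Definition is_main_anti_involution (K : fieldType) (V : lmodType K)
    (A : algType K) (c : {linear V -> A}) (tau : {linear A -> A}) : Prop :=
  [/\ tau 1 = 1, forall x y, tau (x * y) = tau y * tau x
    & forall v, tau (c v) = c v].

Definition Spin (K : fieldType) (V : lmodType K) (A : falgType K)
    (c : {linear V -> A}) : set A :=
  [set g | [/\ Clifford_even c g,
               exists tau : {linear A -> A},
                 is_main_anti_involution c tau /\ g * tau g = 1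
             & forall v, exists v', g * c v * g^-1 = c v']].

(* The image rho_g(U) under the vector representation v |-> g v g^-1. *)
Definition rho_image (K : fieldType) (V : lmodType K) (A : falgType K)
    (c : {linear V -> A}) (g : A) (U : set V) : set V :=
  [set v' | exists2 v, U v & c v' = g * c v * g^-1].

(* An element of H^*(X, L) is given by its coefficients s S on the monomials
   e_S = e_{i1} /\ ... /\ e_{ik}, S = {i1 < ... < ik}, with (e_i) the basis of
   H^1(X, Z).  Write eps i S = (-1)^#{k in S | k < i}.  Then
   e_i /\ e_S = eps i S e_{S u i} for i notin S (and 0 otherwise), and
   e_i^* _| e_S = eps i S e_{S \ i} for i in S (and 0 otherwise). *)
Definition Hstar (m : nat) (L : fieldType) := {ffun {set 'I_m} -> L^o}.

Definition eps (L : fieldType) (m : nat) (i : 'I_m) (S : {set 'I_m}) : L :=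
  (-1) ^+ #|[set k in S | (k < i)%N]|.

Definition wedge (m : nat) (L : fieldType) (w : 'rV[L]_m) (s : Hstar m L) :
    Hstar m L :=
  [ffun S : {set 'I_m} => \sum_(i in S) eps L i S * w 0 i * s (S :\ i)].

Definition contract (m : nat) (L : fieldType) (theta : 'rV[L]_m)
    (s : Hstar m L) : Hstar m L :=
  [ffun S : {set 'I_m} => \sum_(i | i \notin S) eps L i S * theta 0 i * s (i |: S)].

Definition spin_act (m : nat) (L : fieldType) (v : 'rV[L]_(m + m))
    (s : Hstar m L) : Hstar m L :=
  wedge (lsubmx v) s + contract (rsubmx v) s.

Definition Hev (m : nat) (L : fieldType) : set (Hstar m L) :=
  [set s | forall S : {set 'I_m}, odd #|S| -> s S = 0].

(* s |-> s (x) 1, from H^*(X, Q) to H^*(X, C). *)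
Definition Hstar_ratr (m : nat) (L : fieldType) (s : Hstar m rat) : Hstar m L :=
  [ffun S : {set 'I_m} => ratr (s S)].

(* eta t stands for the endomorphism v |-> v *m eta t of V_Q. *)
Definition V_sigma (R : realType) (K : fieldExtType rat) (m : nat)
    (eta : K -> 'M[rat]_(m + m)) (s : {rmorphism K -> R[i]}) :
    set 'rV[R[i]]_(m + m) :=
  [set v | forall t, v *m map_mx ratr (eta t) = s t *: v].

Definition W_T (R : realType) (K : fieldExtType rat) (F : {subfield K})
    (m : nat) (eta : K -> 'M[rat]_(m + m))
    (T : {rmorphism subvs_of F -> R} -> {rmorphism K -> R[i]}) :
    set 'rV[R[i]]_(m + m) :=
  lin_span (\bigcup_(s in [set: {rmorphism subvs_of F -> R}]) V_sigma eta (T s)).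

Definition ell (R : realType) (K : fieldExtType rat) (F : {subfield K})
    (m : nat) (eta : K -> 'M[rat]_(m + m))
    (T : {rmorphism subvs_of F -> R} -> {rmorphism K -> R[i]}) :
    set (Hstar m R[i]) :=
  [set s | forall v, W_T eta T v -> spin_act v s = 0].

(* Main.v *)
Require Import Defs.
From HB Require Import structures.
From mathcomp Require Import all_boot all_order all_algebra all_field.
From mathcomp Require Import boolp classical_sets reals.
From mathcomp Require Import complex.
From mathcomp Require Import ring.
Set Implicit Arguments.
Unset Strict Implicit.
Unset Printing Implicit Defensive.
Import GRing.Theory Num.Theory.
Local Open Scope classical_set_scope.
Local Open Scope ring_scope.

(** Why the span of the ell_T is rational.

    The field K acts on V, and V_C is the direct sum of the eigenspaces
    V_sigma.  Elements of K are adjoint to their conjugates under iota, so the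
    pairing couples V_sigma only with V_sigma' where sigma' = sigma o iota; the
    pairs {sigma, sigma'} correspond to the real places of F.  Products u . u'
    in the Clifford algebra, with u in V_sigma and u' in V_sigma', act on
    spinors, and the combinations of total trace zero form the Lie algebra
    sl(V_sigma).  The point is that the sum of these Lie algebras over all
    places is defined over Q: it consists of the tensors M in V (x) V with
    (eta(t) (x) 1) M = (1 (x) eta(iota t)) M and vanishing traces, which are
    rational linear conditions ([special_tensor]).  The space B is the set of
    even rational spinors killed by all rational special tensors, and the
    theorem says that its complexification is the span of the ell_T.

    Rational linear equations have rationally spanned solutions because any
    complex vector is a combination of rational ones with coefficients that
    are linearly independent over Q ([rational_decomposition]).  It therefore
    suffices to compare complex invariants with the ell_T.  A spinor in ell_T
    is killed by special tensors: at each place one of the two factors kills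
    it, or after one commutation only the trace survives ([special_kills]).
    Conversely let y be killed by special tensors, and take p in V_sigma and
    p' in V_sigma' with (p, p') = 1.  Then p p' and p' p are complementary
    projectors, and invariance forces p p' y to be killed by V_sigma and
    p' p y by V_sigma'.  Splitting y in this way at all the places of F writes
    it as a sum of elements of the ell_T ([balanced_span]).

    That ell_T is even is where the spin group enters.  Base change along an
    embedding of K turns the Clifford algebra of V (x)_F K into operators on
    spinors; the image of g0 is invertible, preserves parity, commutes with
    the vectors of the other places and carries H^1(X^) to V_sigma at its
    place.  Undoing these operators at all places turns an element of ell_T
    into a spinor killed by H^1(X^), that is, into an element of H^0
    ([killed_even]).

    On the rational side, W is the image of the Lagrangian H^1(X^) (x) K under
    an isometry, hence Lagrangian.  This gives both the decomposition
    V = { w + iota w } ([V_split]), by computing an orthogonal complement, and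
    the adjointness of eta(t) and eta(iota t) ([eta_adj]). *)

(** * Spinors and the Clifford relation *)

Section Spinors.
Variables (L : fieldType) (m : nat).
Implicit Types (u v : 'rV[L]_(m + m)) (s t : Hstar m L) (S : {set 'I_m}).

(** Both e_i /\ and the contraction by e_i^* move the coefficient at S to the
    symmetric difference of S and {i}; this makes the two uniform. *)
Definition flip (i : 'I_m) S := if i \in S then S :\ i else i |: S.

Definition flip_coord v S (i : 'I_m) : L :=
  if i \in S then v 0 (lshift m i) else v 0 (rshift m i).

Lemma in_flip i j S : (j \in flip i S) = (i == j) (+) (j \in S).
Proof.
rewrite /flip; case: ifP => iS; rewrite !inE.
  by rewrite eq_sym; case: eqVneq => [<-|//]; rewrite iS.
by rewrite eq_sym; case: eqVneq => [<-|//]; rewrite iS.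
Qed.

Lemma flipK i : involutive (flip i).
Proof. by move=> S; apply/setP => j; rewrite !in_flip addbA addbb. Qed.

Lemma flipC i j S : flip i (flip j S) = flip j (flip i S).
Proof. by apply/setP => k; rewrite !in_flip addbCA. Qed.

Lemma spin_actE v s S :
  spin_act v s S = \sum_i eps L i S * flip_coord v S i * s (flip i S).
Proof.
rewrite !ffunE [RHS](bigID (fun i => i \in S)) /=; congr (_ + _).
  by apply: eq_bigr => i iS; rewrite /flip_coord /flip iS mxE.
by apply: eq_bigr => i /negPf iS; rewrite /flip_coord /flip iS mxE.
Qed.

Lemma epsE (i : 'I_m) S :
  eps L i S = \prod_j (if (j \in S) && (j < i)%N then -1 else 1).
Proof.
rewrite -big_mkcond /= prodr_const /eps; congr (_ ^+ _).
by apply: eq_card => j; rewrite inE.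
Qed.

(** The sign rule behind anticommutation: toggling i changes the number of
    elements below j exactly when i < j. *)
Lemma eps_flip (i j : 'I_m) S : i != j ->
  eps L j (flip i S) = (-1) ^+ (i < j)%N * eps L j S.
Proof.
move=> neq; rewrite !epsE (bigD1 i) //= [in RHS](bigD1 i) //= mulrA.
rewrite in_flip eqxx /=; congr (_ * _); last first.
  by apply: eq_bigr => k ki; rewrite in_flip (negPf (_ : i != k)) // eq_sym.
by case: (i \in S); case: (i < j)%N => /=; rewrite ?expr0 ?expr1 ?mulrNN ?mulr1.
Qed.

Lemma eps_sqr (i : 'I_m) S : eps L i S * eps L i S = 1.
Proof. by rewrite -expr2 -exprM mulnC exprM sqrrN !expr1n. Qed.

Lemma eps_flip_diag (i : 'I_m) S : eps L i (flip i S) = eps L i S.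
Proof.
rewrite !epsE; apply: eq_bigr => k _; rewrite in_flip.
by case: eqVneq => [->|//]; rewrite ltnn !andbF.
Qed.

Lemma Hstar_linE a s t S : (a *: s + t : Hstar m L) S = a * s S + t S.
Proof. by rewrite !ffunE. Qed.

Lemma HstarDE s t S : (s + t : Hstar m L) S = s S + t S.
Proof. by rewrite !ffunE. Qed.

Lemma HstarZE a s S : (a *: s : Hstar m L) S = a * s S.
Proof. by rewrite !ffunE. Qed.

Lemma Hstar0E S : (0 : Hstar m L) S = 0.
Proof. by rewrite !ffunE. Qed.

Lemma spin_act_is_linear v : linear (spin_act v).
Proof.
move=> a s t; apply/ffunP => S; rewrite Hstar_linE !spin_actE.
rewrite mulr_sumr -big_split /=; apply: eq_bigr => i _.
by rewrite Hstar_linE; ring.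
Qed.
HB.instance Definition _ v :=
  GRing.isLinear.Build L (Hstar m L) (Hstar m L) _ (spin_act v)
    (spin_act_is_linear v).

(** Flipping the arguments lets linearity in the vector be declared as well. *)
Definition spin_actr s v := spin_act v s.

Lemma spin_actr_is_linear s : linear (spin_actr s).
Proof.
move=> a u v; apply/ffunP => S.
rewrite Hstar_linE /spin_actr !spin_actE.
rewrite mulr_sumr -big_split /=; apply: eq_bigr => i _.
rewrite /flip_coord; by case: ifP => _; rewrite !mxE; ring.
Qed.
HB.instance Definition _ s :=
  GRing.isLinear.Build L 'rV[L]_(m + m) (Hstar m L) _ (spin_actr s)
    (spin_actr_is_linear s).

Lemma spin_actDl u v s : spin_act (u + v) s = spin_act u s + spin_act v s.
Proof. exact: (linearD (spin_actr s)). Qed.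

Lemma spin_actZl a v s : spin_act (a *: v) s = a *: spin_act v s.
Proof. exact: (linearZZ (spin_actr s)). Qed.

Lemma spin_act_suml (I : finType) (v : I -> 'rV[L]_(m + m)) s :
  spin_act (\sum_i v i) s = \sum_i spin_act (v i) s.
Proof. exact: (linear_sum (spin_actr s)). Qed.

Lemma pairing_VE u v :
  pairing_V u v = \sum_i (u 0 (rshift m i) * v 0 (lshift m i) +
                          v 0 (rshift m i) * u 0 (lshift m i)).
Proof.
rewrite /pairing_V !mxE -big_split /=; apply: eq_bigr => i _.
by rewrite !mxE.
Qed.

(** The terms with distinct indices cancel in pairs by [eps_flip]; those with
    equal indices add up to the pairing, the two orders accounting for i in S
    and i not in S. *)
Lemma spin_act_clifford u v s :
  spin_act u (spin_act v s) + spin_act v (spin_act u s) = pairing_V u v *: s.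
Proof.
apply/ffunP => S; rewrite HstarDE HstarZE pairing_VE !spin_actE.
under eq_bigr do rewrite spin_actE mulr_sumr.
under [X in _ + X]eq_bigr do rewrite spin_actE mulr_sumr.
rewrite [X in _ + X]exchange_big -big_split /= mulr_suml.
apply: eq_bigr => i _; rewrite -big_split /= (bigD1 i) //= big1 ?addr0.
  rewrite !flipK !eps_flip_diag /flip_coord !in_flip eqxx /=.
  case: (i \in S) => /=.
    transitivity ((eps L i S * eps L i S) * ((u 0 (lshift m i) * v 0 (rshift m i) +
      v 0 (lshift m i) * u 0 (rshift m i)) * s S)); first by ring.
    by rewrite eps_sqr; ring.
  transitivity ((eps L i S * eps L i S) * ((u 0 (rshift m i) * v 0 (lshift m i) +
      v 0 (rshift m i) * u 0 (lshift m i)) * s S)); first by ring.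
  by rewrite eps_sqr; ring.
move=> j neq.
rewrite (flipC j i) (eps_flip _ (_ : i != j)) 1?eq_sym // (eps_flip _ neq).
rewrite /flip_coord !in_flip (negPf neq) eq_sym (negPf neq) /=.
have : (-1) ^+ (i < j)%N = - (-1) ^+ (j < i)%N :> L.
  have : (i != j :> nat) by apply: contraNN neq => /eqP/val_inj->.
  by case: ltngtP => //= _ _; rewrite ?expr0 ?expr1 ?opprK.
move=> ->; move: ((-1) ^+ _) (eps _ _ _) (eps _ _ _) => e x y.
by move: (if _ then _ else _) (if _ then _ else _) (s _) => p q z; ring.
Qed.

Lemma spin_act_anticomm u v s : pairing_V u v = 0 ->
  spin_act u (spin_act v s) = - spin_act v (spin_act u s).
Proof.
move=> uv0; apply/eqP; rewrite -addr_eq0; apply/eqP.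
by rewrite spin_act_clifford uv0 scale0r.
Qed.

Lemma spin_actK v s : pairing_V v v = 0 -> (2%:R != 0 :> L) ->
  spin_act v (spin_act v s) = 0.
Proof.
move=> vv0 two0; have := spin_act_clifford v v s.
rewrite vv0 scale0r -mulr2n -scaler_nat => /eqP.
by rewrite scaler_eq0 (negPf two0) => /eqP.
Qed.

(** Spinors concentrated in degrees of parity b. *)
Definition parity_supp (b : bool) s := forall S, odd #|S| != b -> s S = 0.

Lemma odd_flip i S : odd #|flip i S| = ~~ odd #|S|.
Proof.
rewrite /flip; case: ifP => iS; last by rewrite cardsU1 iS.
by rewrite (cardsD1 i S) iS /= negbK.
Qed.

Lemma spin_act_parity b v s : parity_supp b s -> parity_supp (~~ b) (spin_act v s).
Proof.
move=> sb S Sb; rewrite spin_actE big1 // => i _; rewrite sb ?mulr0 //.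
by rewrite odd_flip; case: (odd _) Sb; case: b {sb}.
Qed.

Lemma HevP s : Hev s <-> parity_supp false s.
Proof.
split=> h S; first by rewrite eqbF_neg negbK; apply: h.
by move=> oS; apply: h; rewrite oS.
Qed.

(** Contracting with e_i^* recovers every coefficient at a set containing i, so
    such a spinor lives in H^0. *)
Lemma dual_killed_even s : (forall i, spin_act (row_mx 0 (delta_mx 0 i)) s = 0) ->
  Hev s.
Proof.
move=> h S oS; have [i iS] : exists i, i \in S.
  by apply/set0Pn/eqP => S0; rewrite S0 cards0 in oS.
have /ffunP/(_ (flip i S)) := h i.
rewrite spin_actE Hstar0E (bigD1 i) //= big1 ?addr0 => [|j ji].
  rewrite flipK /flip_coord in_flip eqxx iS /= row_mxEr mxE !eqxx mulr1 => /eqP.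
  by rewrite mulf_eq0 expf_eq0 oppr_eq0 oner_eq0 andbF => /eqP.
rewrite /flip_coord; case: ifP; rewrite ?row_mxEl ?row_mxEr !mxE ?(negPf ji).
  all: by rewrite ?andbF ?mulr0 ?mul0r.
Qed.

End Spinors.

(** * Rational decompositions and linear spans *)

Section BaseChange.
Variables (C : numFieldType).

(** Take a decomposition into rational vectors with the fewest terms: a rational
    relation between the coefficients would allow one to remove a term. *)
Lemma rational_decomposition (I : finType) (x : I -> C) :
  exists r (c : 'I_r -> C) (y : 'I_r -> I -> rat),
    (forall i, x i = \sum_k c k * ratr (y k i)) /\
    (forall q : 'I_r -> rat, \sum_k c k * ratr (q k) = 0 -> forall k, q k = 0).
Proof.
pose P r := `[< exists (c : 'I_r -> C) (y : 'I_r -> I -> rat),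
    forall i, x i = \sum_k c k * ratr (y k i) >].
have exP : exists r, P r.
  exists #|I|; apply/asboolP; exists (fun k => x (enum_val k)).
  exists (fun k i => (i == enum_val k)%:R) => i.
  rewrite (bigD1 (enum_rank i)) //= enum_rankK eqxx rmorph1 mulr1 big1 ?addr0 //.
  move=> k; rewrite -(inj_eq enum_val_inj) enum_rankK eq_sym => /negPf->.
  by rewrite rmorph0 mulr0.
case: (ex_minnP exP) => r /asboolP[c [y xE]] rmin.
exists r, c, y; split=> //; case: r c y xE rmin => [|r] c y xE rmin q q0 k0.
  by case: k0.
apply/eqP/negP => /negP qk0.
suff : P r by move/rmin; rewrite ltnn.
(* Solve the relation q for c k0 and substitute. *)
apply/asboolP; exists (fun k => c (lift k0 k)).
exists (fun k i => y (lift k0 k) i - y k0 i * q (lift k0 k) / q k0) => i.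
have ck0 : c k0 = - \sum_k c (lift k0 k) * ratr (q (lift k0 k) / q k0).
  have rq0 : ratr (q k0) != 0 :> C by rewrite fmorph_eq0.
  apply: (mulIf rq0); move: q0.
  rewrite (bigD1_ord k0) //= => /eqP; rewrite addr_eq0 => /eqP->.
  rewrite mulNr mulr_suml; congr (- _); apply: eq_bigr => k _.
  by rewrite -mulrA -rmorphM /= mulrVK // unitfE.
rewrite xE (bigD1_ord k0) //= ck0 mulNr mulr_suml addrC -sumrB.
by apply: eq_bigr => k _; rewrite rmorphB !rmorphM /=; ring.
Qed.

End BaseChange.

(** A subspace of largest dimension among those contained in P is all of P. *)
Lemma vspace_of_submod (L : fieldType) (V : vectType L) (P : V -> Prop) :
  P 0 -> (forall a u v, P u -> P v -> P (a *: u + v)) ->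
  exists U : {vspace V}, forall v, v \in U <-> P v.
Proof.
move=> P0 PD.
pose Q r := `[< exists U : {vspace V}, (forall v, v \in U -> P v) /\ \dim U = r >].
have exQ : exists r, Q r.
  exists 0%N; apply/asboolP; exists 0%VS; split; last by rewrite dimv0.
  by move=> v; rewrite memv0 => /eqP->.
have Qb r : Q r -> (r <= \dim {:V})%N.
  by move=> /asboolP[U [_ <-]]; apply: dimvS; apply: subvf.
case: (ex_maxnP exQ Qb) => r /asboolP[U [UP Ur]] rmax.
exists U => v; split; first exact: UP.
move=> Pv; have : Q (\dim (U + <[v]>)).
  apply/asboolP; exists (U + <[v]>)%VS; split=> // w.
  case/memv_addP => u uU [v' /vlineP[a ->] ->].
  by rewrite addrC; apply: PD => //; apply: UP.
move/rmax; rewrite -Ur => dimU.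
have /eqP -> : (U == U + <[v]>)%VS by rewrite eqEdim addvSl.
by rewrite (subvP (addvSr _ _)) // memv_line.
Qed.

Section LinSpan.
Variables (L : fieldType) (M : lmodType L).
Implicit Types (A B : set M).

Lemma lin_span_sub A x : A x -> lin_span A x.
Proof.
move=> Ax; exists 1%N, (fun=> 1), (fun=> x); split=> //.
by rewrite big_ord1 scale1r.
Qed.

Lemma lin_spanZ A a x : lin_span A x -> lin_span A (a *: x).
Proof.
move=> [k [c [y [Ay ->]]]]; exists k, (fun i => a * c i), y; split=> //.
by rewrite scaler_sumr; apply: eq_bigr => i _; rewrite scalerA.
Qed.

Lemma lin_spanD A x y : lin_span A x -> lin_span A y -> lin_span A (x + y).
Proof.
move=> [k [c [u [Au ->]]]] [k' [c' [u' [Au' ->]]]].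
exists (k + k')%N, (fun i => match split i with inl a => c a | inr b => c' b end),
  (fun i => match split i with inl a => u a | inr b => u' b end); split.
  by move=> i; case: (split i).
rewrite big_split_ord /=; congr (_ + _); apply: eq_bigr => i _.
  by rewrite (unsplitK (inl i)).
by rewrite (unsplitK (inr i)).
Qed.

Lemma lin_span0 A : lin_span A 0.
Proof.
exists 0%N, (fun=> 0), (fun=> 0); split; first by case.
by rewrite big_ord0.
Qed.

Lemma lin_span_ind (P : M -> Prop) A : P 0 ->
  (forall a x y, P x -> P y -> P (a *: x + y)) -> (forall x, A x -> P x) ->
  forall x, lin_span A x -> P x.
Proof.
move=> P0 PD PA x [k [c [y [Ay ->]]]].
elim/big_rec: _ => // i z _ Pz; apply: PD => //; exact: PA.
Qed.

Lemma lin_span_min A B : (forall x, A x -> lin_span B x) ->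
  lin_span A `<=` lin_span B.
Proof.
move=> AB; apply: lin_span_ind => // [|a x y Bx By]; first exact: lin_span0.
by apply: lin_spanD => //; apply: lin_spanZ.
Qed.

End LinSpan.

(** * Embeddings of a number field *)

Section Embeddings.
Variables (L : fieldExtType rat) (C : numClosedFieldType).

Lemma rat_primitive_element :
  exists (theta : L) (q : {poly rat}),
    [/\ map_poly (in_alg L) q = minPoly 1 theta, separable_poly q,
        size q = (\dim {:L}).+1
      & forall x, exists p, x = fieldExt_horner theta p].
Proof.
have pchar0 : [pchar L] =i pred0 by move=> p; rewrite pchar_lalg; apply: pchar_num.
have sep (x : L) : separable_element 1%AS x.
  by have := pcharf0_separable 1%AS pchar0 x.
have full : fullv = <<1; separable_generator 1 {:L}>>%VS.
  apply: (@eq_adjoin_separable_generator _ _ {:L}%AS 1%AS); last exact: sub1v.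
  by apply/separableP => x _; apply: sep.
move: (separable_generator 1 _) full => theta full.
have /polyOver1P[q qE] := minPolyOver 1%AS theta.
exists theta, q; split=> //.
- by rewrite -(separable_map (in_alg L)) -qE; apply: sep.
- rewrite -(size_map_poly (in_alg L)) -qE size_minPoly; congr _.+1.
  by have := dim_Fadjoin 1%AS theta; rewrite -full dimv1 muln1.
- move=> x; have : x \in <<1; theta>>%VS by rewrite -full memvf.
  by case/Fadjoin1_polyP => p ->; exists p.
Qed.

(** Every element of L is p(theta) for some rational p, and p(theta) determines
    p(z) because the minimal polynomial of theta vanishes at z. *)
Lemma embedding_of_root (theta : L) (q : {poly rat}) (z : C) :
  map_poly (in_alg L) q = minPoly 1 theta ->
  (forall x, exists p, x = fieldExt_horner theta p) ->
  root (map_poly ratr q) z -> exists s : {rmorphism L -> C}, s theta = z.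
Proof.
move=> qE gen qz0; have [p pE] := choice gen.
pose h := horner_morph (fun x => mulrC z (ratr x)).
have hB : {morph h : u v / u - v} by move=> u v; exact: rmorphB.
have hM : {morph h : u v / u * v} by move=> u v; exact: rmorphM.
have hq : h q = 0 by apply/eqP; exact: qz0.
have hK p1 p2 : fieldExt_horner theta p1 = fieldExt_horner theta p2 ->
    h p1 = h p2.
  move=> e; apply/eqP; rewrite -subr_eq0 -hB.
  have : root (map_poly (in_alg L) (p1 - p2)) theta.
    apply/eqP; transitivity (fieldExt_horner theta p1 - fieldExt_horner theta p2).
      exact: (rmorphB (fieldExt_horner theta)).
    by rewrite e subrr.
  move/minPoly_dvdp => /(_ 1%AS); rewrite -qE dvdp_map.
  have -> : map_poly (in_alg L) (p1 - p2) \is a polyOver 1%AS.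
    by apply/polyOver1P; exists (p1 - p2).
  by move/(_ isT)/dvdpP => [r ->]; rewrite hM hq mulr0.
pose s x := h (p x).
have sE r : s (fieldExt_horner theta r) = h r by apply: hK; rewrite -pE.
have sB : zmod_morphism s.
  by move=> x y; rewrite {1}(pE x) {1}(pE y) -rmorphB sE hB.
have sM : monoid_morphism s.
  split; first by rewrite -(rmorph1 (fieldExt_horner theta)) sE; exact: rmorph1.
  by move=> x y; rewrite {1}(pE x) {1}(pE y) -rmorphM sE hM.
pose sA := GRing.isZmodMorphism.Build _ _ _ sB.
pose sMM := GRing.isMonoidMorphism.Build _ _ _ sM.
pose sR : {rmorphism L -> C} := HB.pack s sA sMM.
exists sR; rewrite /sR /= -[theta in s theta]fieldExt_hornerX sE.
exact: horner_morphX.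
Qed.

Definition embedding_mx (s : 'I_(\dim {:L}) -> L -> C) : 'M[C]_(\dim {:L}) :=
  \matrix_(i, k) s i (vbasis {:L})`_k.

(** There are as many embeddings as the degree, and they are linearly
    independent: in the basis of powers of a primitive element their matrix is
    a Vandermonde matrix with distinct nodes. *)
Lemma embedding_exists : exists s : 'I_(\dim {:L}) -> {rmorphism L -> C},
  embedding_mx (fun i => s i) \in unitmx.
Proof.
have [theta [q [qE sepq szq gen]]] := rat_primitive_element.
have [r rE] := closed_field_poly_normal (map_poly ratr q : {poly C}).
have q0 : q != 0 by rewrite -size_poly_eq0 szq.
have lq0 : lead_coef (map_poly ratr q : {poly C}) != 0.
  by rewrite lead_coef_eq0 map_poly_eq0.
have szr : size r = \dim {:L}.
  apply: succn_inj; rewrite -szq -(size_map_poly (ratr : rat -> C)) rE.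
  by rewrite size_scale // size_prod_XsubC.
have unr : uniq r.
  rewrite -separable_prod_XsubC -(eqp_separable (eqp_scale _ lq0)) -rE.
  by rewrite separable_map.
have rroot (i : 'I_(\dim {:L})) : exists s : {rmorphism L -> C}, s theta = r`_i.
  apply: (embedding_of_root qE gen); rewrite rE rootZ //.
  by rewrite root_prod_XsubC mem_nth // szr.
have [s sE] := choice rroot; exists s.
pose P := \matrix_(k < \dim {:L}, l < \dim {:L})
  (ratr (coord (vbasis {:L}) k (theta ^+ l)) : C).
have XP : embedding_mx (fun i => s i) *m P =
    (Vandermonde (\dim {:L}) (\row_i s i theta))^T.
  apply/matrixP => i l; rewrite !mxE -rmorphXn /=.
  rewrite [in RHS](coord_vbasis (memvf (theta ^+ l))) rmorph_sum /=.
  apply: eq_bigr => k _; rewrite !mxE -mulr_algl rmorphM /= mulrC; congr (_ * _).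
  by rewrite alg_num_field fmorph_rat.
have : embedding_mx (fun i => s i) *m P \in unitmx.
  rewrite XP unitmx_tr unitmxE det_Vandermonde unitfE.
  apply/prodf_neq0 => i _; apply/prodf_neq0 => j ij.
  rewrite !mxE !sE subr_eq0 nth_uniq ?szr //.
  by apply: contraTneq ij => ->; rewrite ltnn.
by rewrite unitmx_mul => /andP[].
Qed.

Variable s : 'I_(\dim {:L}) -> {rmorphism L -> C}.
Hypothesis sU : embedding_mx (fun i => s i) \in unitmx.
Local Notation b := (vbasis {:L}).
Local Notation Y := (invmx (embedding_mx (fun i => s i))).

Lemma sum_embedding_dual i j : \sum_(k < \dim {:L}) s i b`_k * Y k j = (i == j)%:R.
Proof.
have /matrixP/(_ i j) := mulmxV sU; rewrite !mxE => <-.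
by apply: eq_bigr => k _; rewrite mxE.
Qed.

Lemma sum_dual_embedding (k l : 'I_(\dim {:L})) : \sum_i Y k i * s i b`_l = (k == l)%:R.
Proof.
have /matrixP/(_ k l) := mulVmx sU; rewrite !mxE => <-.
by apply: eq_bigr => i _; rewrite mxE.
Qed.

Lemma coord_sum (a : L) : a = \sum_(k < \dim {:L}) coord b k a *: b`_k.
Proof. exact: coord_vbasis (memvf a). Qed.

(** The embeddings form a C-basis of the Q-linear maps from L to C; hence every
    additive map into a C-space is a combination of embeddings, with explicit
    coefficients from the inverse matrix. *)
Lemma embedding_expansion (M : lmodType C) (f : {additive L -> M}) (a : L) :
  f a = \sum_i s i a *: \sum_(k < \dim {:L}) Y k i *: f b`_k.
Proof.
have fZ c x : f (c *: x) = ratr c *: f x.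
  apply: (@scalerI _ _ (denq c)%:~R); first by rewrite intr_eq0 denq_eq0.
  rewrite scaler_int -raddfMz -scaler_int !scalerA.
  have -> : (denq c)%:~R * c = (numq c)%:~R.
    by rewrite mulrC -{1}(divq_num_den c) divfK // intr_eq0 denq_eq0.
  have -> : (denq c)%:~R * ratr c = (numq c)%:~R :> C.
    by rewrite /ratr mulrC divfK // intr_eq0 denq_eq0.
  by rewrite !scaler_int raddfMz.
have sZ i c x : s i (c *: x) = ratr c * s i x.
  by rewrite -mulr_algl rmorphM /= alg_num_field fmorph_rat.
rewrite {1}(coord_sum a) raddf_sum /=.
under [RHS]eq_bigr do rewrite {1}(coord_sum a) rmorph_sum scaler_suml.
rewrite exchange_big /=; apply: eq_bigr => l _.
under eq_bigr do rewrite sZ -scalerA scaler_sumr.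
rewrite -scaler_sumr fZ; congr (_ *: _).
rewrite exchange_big /= (bigD1 l) //= [X in _ + X]big1 ?addr0.
  under eq_bigr do rewrite scalerA mulrC.
  by rewrite -scaler_suml sum_dual_embedding eqxx scale1r.
move=> k /negPf kl; under eq_bigr do rewrite scalerA mulrC.
by rewrite -scaler_suml sum_dual_embedding kl scale0r.
Qed.

(** The matrix of embeddings diagonalises multiplication by a. *)
Lemma field_trace_embeddings (a : L) : ratr (field_trace a) = \sum_i s i a.
Proof.
pose X := embedding_mx (fun i => s i).
pose N := \matrix_(k < \dim {:L}, l < \dim {:L}) (ratr (coord b k (a * b`_l)) : C).
pose D := diag_mx (\row_i s i a).
have sZ i c x : s i (c *: x) = ratr c * s i x.
  by rewrite -mulr_algl rmorphM /= alg_num_field fmorph_rat.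
have XN : X *m N = D *m X.
  apply/matrixP => i l; rewrite mul_diag_mx !mxE -rmorphM.
  rewrite [in RHS](coord_sum (a * _)) rmorph_sum; apply: eq_bigr => k _.
  by rewrite !mxE sZ mulrC.
transitivity (\tr N).
  by rewrite rmorph_sum; apply: eq_bigr => k _; rewrite mxE.
have -> : N = invmx X *m (D *m X) by rewrite -XN mulKmx.
rewrite mxtrace_mulC -mulmxA mulmxV // mulmx1 mxtrace_diag.
by apply: eq_bigr => i _; rewrite mxE.
Qed.

End Embeddings.

(** * The quadratic extension K/F *)

Lemma ext_natr_neq0 (L : fieldExtType rat) n : (n.+1%:R : L) != 0.
Proof. by rewrite -(rmorph_nat (in_alg L)) fmorph_eq0 pnatr_eq0. Qed.

Lemma totally_real_proper (R : realType) (K : fieldExtType rat) (F : {subfield K}) :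
  totally_imaginary R K -> totally_real R (subvs_of F) -> (F : {vspace K}) <> fullv.
Proof.
move=> imK reF Ffull.
have [s _] := embedding_exists K R[i].
have [x] := imK (s (Ordinal (adim_gt0 {:K}%AS))); move: (s _) => {}s.
have := reF (s \o vsval) (vsproj F x).
by rewrite /= vsprojK ?Ffull ?memvf // => ->; rewrite eqxx.
Qed.

(** F contains the totally real subfield given by the CM property; as that one
    has index 2 and F is not K, they coincide. *)
Lemma CM_degree2 (R : realType) (K : fieldExtType rat) (F : {subfield K}) :
  CM_field R K -> max_totally_real R F -> \dim_F {:K} = 2%N.
Proof.
move=> [imK [F' [reF' dimF']]] [reF maxF].
have sF'F := maxF _ reF'.
have dK := dim_sup_field (subvf F'); rewrite dimF' in dK.
have dF := dim_sup_field sF'F.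
have dKF := dim_sup_field (subvf F).
have F'0 : (0 < \dim F')%N := adim_gt0 F'.
move: (\dim_F {:K}) (\dim_F' F) dKF dF => k l dKF dF.
have kl : (k * l = 2)%N.
  by apply/eqP; rewrite -(eqn_pmul2r F'0) -mulnA -dF -dKF dK.
have : (k %| 2)%N by rewrite -kl dvdn_mulr.
case/primeP: (isT : prime 2) => _ /[apply] /pred2P[k1|//].
case: (totally_real_proper imK reF).
by apply/eqP; rewrite eqEdim subvf /= dKF k1 mul1n.
Qed.

(** For x moved by iota, x satisfies a quadratic equation over F whose other
    root is iota x; then zeta = x - iota x generates K and is anti-invariant. *)
Lemma Gal_generator_split (K : fieldExtType rat) (F : {subfield K})
    (iota : {rmorphism K -> K}) :
  \dim_F {:K} = 2%N -> Gal_generator F iota ->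
  exists zeta, [/\ zeta != 0, iota zeta = - zeta,
    forall x, exists a b : subvs_of F, x = vsval a + vsval b * zeta
    & exists delta : subvs_of F, vsval delta = zeta ^+ 2].
Proof.
move=> dK [iotaF [x ix]].
have xF : x \notin F by apply: contraNN ix => /iotaF->.
have dKF := dim_sup_field (subvf F); rewrite dK in dKF.
have F0 : (0 < \dim F)%N := adim_gt0 F.
have deg : adjoin_degree F x = 2%N.
  have := adjoin_deg_eq1 F x; rewrite (negPf xF).
  have : (adjoin_degree F x * \dim F <= 2 * \dim F)%N.
    by rewrite -dim_Fadjoin -dKF; apply: dimvS (subvf _).
  rewrite leq_pmul2r //; rewrite /adjoin_degree.
  by case: (_.-1) => [|[|k]].
have full : <<F; x>>%VS = fullv.
  by apply/eqP; rewrite eqEdim subvf /= dim_Fadjoin deg dKF.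
have gen y : exists a b, [/\ a \in F, b \in F & y = a + b * x].
  have yx : y \in <<F; x>>%VS by rewrite full memvf.
  have /polyOverP pF := Fadjoin_polyOver F x y.
  have := size_Fadjoin_poly F x y; rewrite deg => szp.
  exists (Fadjoin_poly F x y)`_0, (Fadjoin_poly F x y)`_1; split=> //.
  rewrite -[LHS](Fadjoin_poly_eq yx) (horner_coef_wide _ szp).
  by rewrite big_ord_recl big_ord1 expr0 expr1 mulr1.
have [b [a [bF aF xx]]] := gen (x ^+ 2).
have ixE : iota x = a - x.
  have : iota (x ^+ 2) = iota (b + a * x) by rewrite xx.
  rewrite rmorphXn rmorphD rmorphM /= (iotaF a aF) (iotaF b bF) => ixx.
  have : (iota x - x) * (iota x - (a - x)) = 0.
    transitivity (iota x ^+ 2 - x ^+ 2 - a * (iota x - x)); first by ring.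
    by rewrite ixx xx; ring.
  by move/eqP; rewrite mulf_eq0 !subr_eq0 (negPf ix) => /eqP.
have two : (2%:R : K) != 0 := ext_natr_neq0 K 1.
exists (x *+ 2 - a); split.
- rewrite subr_eq0; apply: contraNneq xF => x2a.
  have -> : x = 2%:R^-1 * a by rewrite -x2a -[x *+ 2]mulr_natl mulKf.
  by rewrite rpredM ?rpredV ?rpred_nat.
- by rewrite rmorphB rmorphMn /= ixE (iotaF a aF); ring.
- move=> y; have [u [v [uF vF ->]]] := gen y.
  have v2F : v / 2%:R \in F by rewrite rpred_div // rpred_nat.
  have uvF : u + v / 2%:R * a \in F by rewrite rpredD // rpredM.
  exists (vsproj F (u + v / 2%:R * a)), (vsproj F (v / 2%:R)).
  by rewrite !vsprojK //; field.
exists (vsproj F (b *+ 4 + a ^+ 2)); rewrite vsprojK.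
  transitivity ((x ^+ 2) *+ 4 + a ^+ 2 - (a * x) *+ 4); last by ring.
  by rewrite xx; ring.
by rewrite rpredD ?rpredMn ?rpredX.
Qed.

(** * Induction on a scalar extension *)

(** Bundling the predicate with its closure properties lets the module structure
    of the corresponding subtype be inferred. *)
Record submodule_prop (K : fieldType) (M : lmodType K) := SubmoduleProp {
  submod_prop :> M -> Prop;
  submod_prop0 : submod_prop 0;
  submod_propD : forall t x y,
    submod_prop x -> submod_prop y -> submod_prop (t *: x + y) }.

Section SubmoduleOfProp.
Variables (K : fieldType) (M : lmodType K) (P : submodule_prop M).

Definition submod_pred : {pred M} := fun x => `[< P x >].

Lemma submod_pred_closed : submod_closed submod_pred.
Proof.
split; first by apply/asboolP; apply: submod_prop0.
by move=> t x y /asboolP Px /asboolP Py; apply/asboolP; apply: submod_propD.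
Qed.
HB.instance Definition _ :=
  GRing.isSubmodClosed.Build K M submod_pred submod_pred_closed.

Definition submodule_of := {x : M | x \in submod_pred}.
HB.instance Definition _ := SubChoice.on submodule_of.
HB.instance Definition _ := [SubChoice_isSubLmodule of submodule_of by <:].

End SubmoduleOfProp.

(** The universal property makes j factor through the submodule cut out by P;
    composing with the inclusion gives an endomorphism that agrees with the
    identity on the image of j, hence is the identity. *)
Lemma scalar_extension_ind (K : fieldExtType rat) (F : {subfield K})
  (V : zmodType) (act : subvs_of F -> V -> V) (VK : lmodType K)
  (j : {additive V -> VK}) (P : VK -> Prop) :
  is_scalar_extension act j -> P 0 ->
  (forall t x y, P x -> P y -> P (t *: x + y)) ->
  (forall v, P (j v)) -> forall x, P x.
Proof.
move=> [jact univ] P0 PD Pj x.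
pose S := submodule_of (SubmoduleProp P0 PD).
pose f v : S := exist _ (j v) (asboolT (Pj v)).
have fB : zmod_morphism f by move=> u v; apply: val_inj; rewrite /= !raddfB.
pose fA := GRing.isZmodMorphism.Build _ _ _ fB.
pose fL : {additive V -> S} := HB.pack f fA.
have [g [gj _]] : exists g : {linear VK -> S}, (forall v, g (j v) = fL v) /\
    forall h : {linear VK -> S}, (forall v, h (j v) = fL v) -> h =1 g.
  by apply: univ => a v; apply: val_inj; rewrite /= jact.
have [g0 [_ uniq]] := univ VK j jact.
have e1 : val \o g =1 g0 by apply: uniq => v; rewrite /= gj.
have e2 : idfun =1 g0 by apply: uniq.
have := valP (g x); rewrite -[val _]/((val \o g) x) e1 -e2.
by move/asboolP.
Qed.

(** * The pairing on V *)

Section PairingMatrix.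
Variables (L : fieldType) (m : nat).
Implicit Types (u v w : 'rV[L]_(m + m)).

Definition pairing_mx : 'M[L]_(m + m) := block_mx 0 1%:M 1%:M 0.

Lemma pairing_VJ u v : pairing_V u v = (u *m pairing_mx *m v^T) 0 0.
Proof.
rewrite /pairing_V -[in RHS](hsubmxK u) -[in RHS](hsubmxK v) /pairing_mx.
rewrite mul_row_block !mulmx0 !mulmx1 addr0 add0r tr_row_mx mul_row_col.
by rewrite !mxE; congr (_ + _); apply: eq_bigr => i _; rewrite !mxE mulrC.
Qed.

Lemma pairing_VC u v : pairing_V u v = pairing_V v u.
Proof. by rewrite /pairing_V addrC. Qed.

Lemma pairing_VDl u v w : pairing_V (u + v) w = pairing_V u w + pairing_V v w.
Proof. by rewrite !pairing_VJ !mulmxDl mxE. Qed.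

Lemma pairing_VZl a u v : pairing_V (a *: u) v = a * pairing_V u v.
Proof. by rewrite !pairing_VJ -!scalemxAl mxE. Qed.

Lemma pairing_VZr a u v : pairing_V u (a *: v) = a * pairing_V u v.
Proof. by rewrite pairing_VC pairing_VZl pairing_VC. Qed.

Lemma pairing_VDr u v w : pairing_V w (u + v) = pairing_V w u + pairing_V w v.
Proof. by rewrite !(pairing_VC w) pairing_VDl. Qed.

Lemma pairing_V0l u : pairing_V 0 u = 0.
Proof. by rewrite -(scale0r 0) pairing_VZl mul0r. Qed.

Lemma pairing_V_suml (I : finType) (x : I -> 'rV[L]_(m + m)) v :
  pairing_V (\sum_i x i) v = \sum_i pairing_V (x i) v.
Proof.
apply: (big_ind2 (fun a b => pairing_V a v = b)) => [|a _ b _ <- <-|//].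
  exact: pairing_V0l.
exact: pairing_VDl.
Qed.

Lemma pairing_mxK : pairing_mx *m pairing_mx = 1%:M.
Proof.
by rewrite mulmx_block !mulmx0 !mul0mx !mulmx1 !addr0 !add0r -scalar_mx_block.
Qed.

Lemma pairing_V_nondeg v : (forall u, pairing_V u v = 0) -> v = 0.
Proof.
move=> h; have Jv0 : pairing_mx *m v^T = 0.
  apply/matrixP => i k; rewrite (ord1 k) [RHS]mxE -(h (delta_mx 0 i)) pairing_VJ.
  by rewrite -mulmxA -rowE [RHS]mxE.
by apply: trmx_inj; rewrite trmx0 -[v^T]mul1mx -pairing_mxK -mulmxA Jv0 mulmx0.
Qed.

(** The orthogonal of U is a kernel of dimension at least dim V - dim U. *)
Lemma orthogonal0_full (U : {vspace 'rV[L]_(m + m)}) :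
  (forall v, (forall u, u \in U -> pairing_V v u = 0) -> v = 0) ->
  forall v, v \in U.
Proof.
move=> perp0 v.
pose B := \matrix_(i < \dim U) (vbasis U)`_i.
pose N := pairing_mx *m B^T.
have kerN : kermx N = 0.
  apply/eqP/rowV0P => w /sub_kermxP wN; apply: perp0 => u uU.
  rewrite (coord_vbasis uU) pairing_VC pairing_V_suml big1 // => i _.
  rewrite pairing_VZl pairing_VC pairing_VJ -mulmxA.
  have := congr1 (fun A : 'rV[L]_(\dim U) => A 0 i) wN.
  rewrite /N mulmxA mxE [RHS]mxE => wNi.
  suff -> : (w *m (pairing_mx *m ((vbasis U)`_i)^T)) 0 0 = 0 by rewrite mulr0.
  rewrite mulmxA mxE -[RHS]wNi; apply: eq_bigr => k _.
  by rewrite !mxE.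
have : (\rank N <= \dim U)%N by exact: rank_leq_col.
have := mxrank_ker N; rewrite kerN mxrank0 => /esym/eqP.
rewrite subn_eq0 => h1 h2.
have -> : U = fullv by apply/eqP; rewrite eqEdim subvf dimvf /dim /= mul1n (leq_trans h1).
exact: memvf.
Qed.

End PairingMatrix.

Lemma field_trace1 (L : fieldExtType rat) : field_trace (1 : L) = (\dim {:L})%:R.
Proof.
rewrite /field_trace; under eq_bigr do rewrite mul1r coord_free ?eqxx
  ?(basis_free (vbasisP _)) //.
by rewrite sumr_const card_ord.
Qed.

(** The trace of 1 is the degree, which is nonzero. *)
Lemma field_trace_nondeg (L : fieldExtType rat) (x : L) :
  (forall a, field_trace (a * x) = 0) -> x = 0.
Proof.
move=> h; apply/eqP/negP => /negP x0.
have := h x^-1; rewrite mulVf // field_trace1 => /eqP.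
by rewrite pnatr_eq0 gtn_eqF // (adim_gt0 {:L}%AS).
Qed.

Lemma field_trace0 (L : fieldExtType rat) : field_trace (0 : L) = 0.
Proof.
by rewrite /field_trace big1 // => i _; rewrite mul0r linear0.
Qed.

Lemma vsval_eq0 (K : fieldExtType rat) (F : {subfield K}) (a : subvs_of F) :
  vsval a = 0 -> a = 0.
Proof. by move=> a0; apply: val_inj. Qed.

(** * The Lagrangian W and the action of K on V *)

Section ScalarExtension.
Variables (K : fieldExtType rat) (F : {subfield K}) (iota : {rmorphism K -> K}).
Hypothesis iotaF : forall a, a \in F -> iota a = a.
Variable zeta : K.
Hypothesis zeta0 : zeta != 0.
Hypothesis iota_zeta : iota zeta = - zeta.
Hypothesis zeta_gen : forall x, exists a b : subvs_of F, x = vsval a + vsval b * zeta.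
Variable delta : subvs_of F.
Hypothesis zeta2 : vsval delta = zeta ^+ 2.
Variables (m : nat) (rho : {rmorphism subvs_of F -> 'M[rat]_(m + m)}).
Local Notation V := 'rV[rat]_(m + m).
Variable bF : V -> V -> subvs_of F.
Hypothesis hbF : is_F_pairing (fun a v => v *m rho a) bF.
Variables (VK : lmodType K) (j : {additive V -> VK}).
Hypothesis hVK : is_scalar_extension (fun a v => v *m rho a) j.
Variable bK : VK -> VK -> K.
Hypothesis hbK : is_K_pairing bF j bK.
Variable iotaV : {additive VK -> VK}.
Hypothesis hiotaV : is_second_factor_action iota j iotaV.

Let bFC u v : bF u v = bF v u. Proof. by case: hbF. Qed.
Let bFZ a u v : bF (u *m rho a) v = a * bF u v. Proof. by case: hbF. Qed.
Let bFtr u v : field_trace (bF u v) = pairing_V u v. Proof. by case: hbF. Qed.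
Let bKDl x y z : bK (x + y) z = bK x z + bK y z. Proof. by case: hbK. Qed.
Let bKDr x y z : bK z (x + y) = bK z x + bK z y. Proof. by case: hbK. Qed.
Let bKZl t x y : bK (t *: x) y = t * bK x y. Proof. by case: hbK. Qed.
Let bKZr t x y : bK x (t *: y) = t * bK x y. Proof. by case: hbK. Qed.
Let bKj u v : bK (j u) (j v) = vsval (bF u v). Proof. by case: hbK. Qed.
Let jZ a v : j (v *m rho a) = vsval a *: j v. Proof. by case: hVK. Qed.
Let iotaVZ t x : iotaV (t *: x) = iota t *: iotaV x. Proof. by case: hiotaV. Qed.
Let iotaVj v : iotaV (j v) = j v. Proof. by case: hiotaV. Qed.
Let bK0l x : bK 0 x = 0. Proof. by rewrite -(scale0r 0) bKZl mul0r. Qed.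
Let bK0r x : bK x 0 = 0. Proof. by rewrite -(scale0r 0) bKZr mul0r. Qed.
Lemma bF_eq0 u v : (forall a, pairing_V (u *m rho a) v = 0) -> bF u v = 0.
Proof. by move=> h; apply: field_trace_nondeg => a; rewrite -bFZ bFtr. Qed.

Lemma bF_nondeg v : (forall u, bF u v = 0) -> v = 0.
Proof.
by move=> h; apply: pairing_V_nondeg => u; rewrite -bFtr h field_trace0.
Qed.

Lemma pairing_V_rho a u v : pairing_V (u *m rho a) v = pairing_V u (v *m rho a).
Proof. by rewrite -!bFtr bFZ [in RHS]bFC bFZ bFC. Qed.

(** The kernel of j is orthogonal to everything. *)
Lemma j_inj : injective j.
Proof.
move=> u v juv; apply/eqP; rewrite -subr_eq0; apply/eqP.
apply: bF_nondeg => w; apply: vsval_eq0.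
by rewrite -bKj raddfB juv subrr bK0r.
Qed.

Lemma rho_rat q : rho (q *: 1) = q%:M.
Proof.
have -> : rho (q *: 1) = q *: rho 1 := rat_linear (raddfB rho) q 1.
rewrite rmorph1.
by apply/matrixP => i k; rewrite !mxE mulr_natr.
Qed.

(** V (x)_F K = V + zeta V: the right-hand side is stable under K since zeta^2
    lies in F. *)
Lemma VK_split x : exists a b, x = j a + zeta *: j b.
Proof.
move: x; apply: (scalar_extension_ind hVK) => [|t x y [a [b ->]] [a' [b' ->]]|v].
- by exists 0, 0; rewrite raddf0 scaler0 addr0.
- have [p [q ->]] := zeta_gen t.
  exists (a *m rho p + b *m rho (q * delta) + a'),
    (a *m rho q + b *m rho p + b').
  rewrite !(raddfD j) !jZ rmorphM /= zeta2 !scalerDr !addrA; congr (_ + _).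
  rewrite -!addrA [j a' + _]addrC !addrA; congr (_ + _).
  rewrite !scalerDl !scalerA -!addrA; congr (_ + _).
  rewrite addrCA; congr (_ + _).
    by congr (_ *: _); ring.
  rewrite addrC; congr (_ + _); congr (_ *: _); ring.
- by exists v, 0; rewrite raddf0 scaler0 addr0.
Qed.


Lemma iotaV_split a b : iotaV (j a + zeta *: j b) = j a - zeta *: j b.
Proof. by rewrite raddfD iotaVZ !iotaVj iota_zeta scaleNr. Qed.

Lemma iota_F (a : subvs_of F) : iota (vsval a) = vsval a.
Proof. exact: iotaF (subvsP a). Qed.

Lemma bK_iota x y : bK (iotaV x) (iotaV y) = iota (bK x y).
Proof.
have [a [b ->]] := VK_split x; have [a' [b' ->]] := VK_split y.
rewrite !iotaV_split -!scaleNr !(bKDl, bKDr, bKZl, bKZr, bKj).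
by rewrite !(rmorphD, rmorphM) /= !iota_F iota_zeta.
Qed.

Lemma bKC x y : bK x y = bK y x.
Proof.
have [a [b ->]] := VK_split x; have [a' [b' ->]] := VK_split y.
rewrite !(bKDl, bKDr, bKZl, bKZr, bKj).
by rewrite (bFC a' a) (bFC a' b) (bFC b' a) (bFC b' b); ring.
Qed.

Lemma add_iotaV x : exists v, j v = x + iotaV x.
Proof.
have [a [b ->]] := VK_split x; exists (a + a).
by rewrite iotaV_split raddfD addrACA subrr addr0.
Qed.

Lemma zeta_indep (a b : subvs_of F) : vsval a + zeta * vsval b = 0 -> a = 0 /\ b = 0.
Proof.
move=> e0; have e1 : vsval a - zeta * vsval b = 0.
  by rewrite -(rmorph0 iota) -e0 rmorphD rmorphM /= !iota_F iota_zeta mulNr.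
have a0 : vsval a = 0.
  apply/eqP; have : 2%:R * vsval a = 0.
    by rewrite -[RHS](addr0 0) -{1}e0 -e1; ring.
  by move/eqP; rewrite mulf_eq0 (negPf (ext_natr_neq0 K 1)).
split; apply: vsval_eq0 => //; apply/eqP.
by move/eqP: e0; rewrite a0 add0r mulf_eq0 (negPf zeta0).
Qed.

Section Lagrangian.
Variable W : set VK.
Hypothesis WD : forall t x y, W x -> W y -> W (t *: x + y).
Hypothesis W0 : W 0.
Hypothesis Wiso : forall x y, W x -> W y -> bK x y = 0.
Hypothesis Wmax : forall x, (forall y, W y -> bK x y = 0) -> W x.
Hypothesis Wiota : W `&` (iotaV @` W) = [set 0].

Let WZ t x : W x -> W (t *: x).
Proof. by move=> Wx; rewrite -[_ *: _]addr0; apply: WD. Qed.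

(** The vectors of this form make up a rational subspace.  If v is orthogonal to
    it then j v, being fixed by iota, is orthogonal to W (pair it with the vectors
    attached to w and to zeta w); so j v lies in W and in iota W, which meet in 0. *)
Lemma V_split v : exists2 w, W w & j v = w + iotaV w.
Proof.
pose P v := exists2 w, W w & j v = w + iotaV w.
have P0 : P 0 by exists 0; rewrite // !raddf0 addr0.
have Prho a u : P u -> P (u *m rho a).
  move=> [w Ww ju]; exists (vsval a *: w); first exact: WZ.
  by rewrite jZ ju scalerDr iotaVZ iota_F.
have PZ q u : P u -> P (q *: u).
  by rewrite -mul_mx_scalar -rho_rat; apply: Prho.
have PD q u u' : P u -> P u' -> P (q *: u + u').
  move/(PZ q) => [w Ww ju] [w' Ww' ju']; exists (w + w').
    by rewrite -[w]scale1r; apply: WD.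
  by rewrite !raddfD ju ju' /= addrACA.
have [U UP] := vspace_of_submod P0 PD.
apply/UP; apply: orthogonal0_full => {}v perp.
have jvP u : P u -> bK (j v) (j u) = 0.
  move=> Pu; rewrite bKj bF_eq0 ?linear0 // => a.
  by rewrite pairing_V_rho; apply: perp; apply/UP; apply: Prho.
have iv x : bK (j v) (iotaV x) = iota (bK (j v) x) by rewrite -bK_iota iotaVj.
have Wv : W (j v).
  apply: Wmax => w Ww.
  have h t : t * bK (j v) w + iota t * iota (bK (j v) w) = 0.
    have [u ju] := add_iotaV (t *: w).
    rewrite -(jvP u) ?ju; last by exists (t *: w); [apply: WZ|].
    by rewrite bKDr iotaVZ !bKZr iv.
  have h1 := h 1; have hz := h zeta; rewrite rmorph1 !mul1r in h1.
  rewrite iota_zeta in hz.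
  have : 2%:R * zeta * bK (j v) w = 0.
    transitivity (zeta * (bK (j v) w + iota (bK (j v) w)) +
      (zeta * bK (j v) w + - zeta * iota (bK (j v) w))); first by ring.
    by rewrite h1 hz mulr0 addr0.
  move/eqP; rewrite !mulf_eq0 (negPf (ext_natr_neq0 K 1)) (negPf zeta0) /=.
  by move/eqP.
apply: j_inj; rewrite raddf0.
have : (W `&` (iotaV @` W)) (j v) by split=> //; exists (j v).
by rewrite Wiota.
Qed.

Variable eta : K -> 'M[rat]_(m + m).
Hypothesis heta : forall (t : K) (v : V) (w : VK), W w ->
  j v = w + iotaV w -> j (v *m eta t) = t *: w + iotaV (t *: w).

Lemma mx_ext (M N : 'M[rat]_(m + m)) : (forall v : V, v *m M = v *m N) -> M = N.
Proof. by move=> h; apply/row_matrixP => i; rewrite !rowE h. Qed.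

Lemma eta_F (a : subvs_of F) : eta (vsval a) = rho a.
Proof.
apply: mx_ext => v; apply: j_inj; have [w Ww jv] := V_split v.
by rewrite (heta _ Ww jv) jZ jv iotaVZ iota_F scalerDr.
Qed.

Lemma etaD s t : eta (s + t) = eta s + eta t.
Proof.
apply: mx_ext => v; apply: j_inj; have [w Ww jv] := V_split v.
rewrite mulmxDr raddfD /= !(heta _ Ww jv) scalerDl raddfD /=.
by rewrite addrACA.
Qed.

Lemma etaM s t : eta (s * t) = eta s *m eta t.
Proof.
apply: mx_ext => v; apply: j_inj; have [w Ww jv] := V_split v.
rewrite mulmxA (heta _ Ww jv) (heta _ (WZ s Ww) (heta _ Ww jv)).
by rewrite scalerA mulrC.
Qed.

(** W and iota W are isotropic, so only the products of W with iota W count, and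
    iota exchanges the two factors. *)
Lemma eta_adj t u v : pairing_V (u *m eta t) v = pairing_V u (v *m eta (iota t)).
Proof.
rewrite -!bFtr; congr field_trace; apply: val_inj; rewrite /= -!bKj.
have [w Ww jv] := V_split v; have [w' Ww' ju] := V_split u.
rewrite (heta _ Ww jv) (heta _ Ww' ju) jv ju !(bKDl, bKDr).
rewrite !iotaVZ !(bKZl, bKZr) !bK_iota !(Wiso Ww' Ww).
have iotaK : iota (iota t) = t.
  have [a [b ->]] := zeta_gen t.
  by rewrite !(rmorphD, rmorphM) /= iota_zeta rmorphN /= iota_zeta !iota_F opprK.
by rewrite iotaK rmorph0 !mulr0 !add0r !addr0 addrC; congr (_ + _).
Qed.

(** If j v = w + iota w then j (v eta(zeta)) = zeta w - zeta iota w. *)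
Lemma W_recover w : W w -> exists v,
  w = 2%:R^-1 *: (j v + zeta^-1 *: j (v *m eta zeta)).
Proof.
move=> Ww; have [v jv] := add_iotaV w; exists v.
rewrite (heta _ Ww jv) jv iotaVZ iota_zeta [zeta^-1 *: _]scalerDr !scalerA.
rewrite mulrN mulVf // scaleN1r scale1r addrACA subrr addr0 -mulr2n -[w *+ 2]scaler_nat.
by rewrite scalerA mulVf ?scale1r // ext_natr_neq0.
Qed.

End Lagrangian.

End ScalarExtension.

(** * Rotations by elements of the spin group *)

Section CliffordRotation.
Variables (K : fieldType) (V : lmodType K) (b : V -> V -> K).
Hypothesis bC : forall x y, b x y = b y x.
Hypothesis bD : forall x y z, b (x + y) z = b x z + b y z.
Hypothesis two_neq0 : 2%:R != 0 :> K.

Lemma clifford_polar (A : algType K) (f : V -> A) :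
  {morph f : x y / x + y} ->
  (forall v, f v * f v = (b v v / 2%:R)%:A) ->
  forall x y, f x * f y + f y * f x = (b x y)%:A.
Proof.
move=> fD sq x y; have := sq (x + y).
rewrite fD mulrDl !mulrDr !sq !bD !(bC _ (x + y)) !bD (bC y x) => e.
apply: (@addrI _ ((b x x / 2%:R)%:A + (b y y / 2%:R)%:A)).
rewrite addrACA [_%:A + f y * f x]addrC e -!scalerDl; congr (_ *: _).
by field.
Qed.

Variables (A : falgType K) (c : {linear V -> A}).
Hypothesis hA : is_Clifford_algebra b c.
Variables (g0 : A).
Hypothesis hg0 : Spin c g0.

(** In finite dimension the injective right multiplication by x is onto. *)
Lemma falg_left_inverse (x y : A) : x * y = 1 -> y * x = 1.
Proof.
move=> xy1; have inj : lker (amulr x) == 0%VS.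
  apply/lker0P => u v; rewrite !lfunE /= => /(congr1 (fun z => z * y)).
  by rewrite -!mulrA xy1 !mulr1.
have zx : (amulr x)^-1%VF 1 * x = 1.
  by have := lker0_lfunVK inj 1; rewrite lfunE.
by rewrite -[y]mul1r -{1}zx -(mulrA _ x y) xy1 mulr1.
Qed.

Lemma spin_unit : g0 \is a GRing.unit.
Proof.
case: hg0 => _ [tau [_ gt]] _; apply/unitrP; exists (tau g0).
by rewrite gt (falg_left_inverse gt).
Qed.

Local Notation rot v v' := (c v' = g0 * c v * g0^-1).

Lemma rot_ex v : exists v', rot v v'.
Proof. by case: hg0 => _ _ /(_ v)[v' e]; exists v'. Qed.

Lemma in_alg_inj (t t' : K) : t%:A = t'%:A :> A -> t = t'.
Proof.
move/eqP; rewrite -subr_eq0 -scalerBl scaler_eq0 oner_eq0 orbF subr_eq0.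
by move/eqP.
Qed.

(** The form is recovered from the anticommutator, which conjugation preserves. *)
Lemma rot_isometry u u' v v' : rot u u' -> rot v v' -> b u' v' = b u v.
Proof.
move=> ru rv; have pol x y : c x * c y + c y * c x = (b x y)%:A.
  exact: (clifford_polar (raddfD c) (proj1 hA)).
apply: in_alg_inj; rewrite -!pol ru rv.
have conjM x y : (g0 * x * g0^-1) * (g0 * y * g0^-1) = g0 * (x * y) * g0^-1.
  by rewrite !mulrA mulrVK ?spin_unit.
rewrite !conjM -mulrDl -mulrDr pol -mulr_algl.
by rewrite mulr1 -scalerAr mulr1 -scalerAl divrr ?spin_unit.
Qed.

(** Conjugation by g0 is injective and maps the finite-dimensional space c V
    into itself. *)
Lemma rot_surj v' : exists v, rot v v'.
Proof.
have [|a _ _ [u ->] [v ->]|U UP] := @vspace_of_submod K A (fun y => exists v, y = c v).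
- by exists 0; rewrite linear0.
- by exists (a *: u + v); rewrite linearP.
pose f : 'End(A) := (amulr (g0^-1)%R \o amull g0)%VF.
have fE x : f x = g0 * x * g0^-1 by rewrite lfunE /= !lfunE.
have fU : (f @: U)%VS = U.
  apply/eqP; rewrite eqEdim; apply/andP; split.
    apply/subvP => _ /memv_imgP[x /UP[v ->] ->]; apply/UP.
    by rewrite fE; have [w <-] := rot_ex v; exists w.
  rewrite limg_dim_eq //; apply/eqP; rewrite -subv0; apply/subvP => x.
  rewrite memv_cap memv_ker memv0 fE => /andP[_ /eqP fx0].
  by rewrite -(mulKr spin_unit x) -(mulrVK spin_unit (g0 * x)) fx0 mul0r mulr0.
have : c v' \in U by apply/UP; exists v'.
by rewrite -fU => /memv_imgP[_ /UP[v ->]]; rewrite fE; exists v.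
Qed.

Variable U : set V.
Hypothesis U0 : U 0.
Hypothesis UD : forall t x y, U x -> U y -> U (t *: x + y).
Hypothesis Uiso : forall x y, U x -> U y -> b x y = 0.
Hypothesis Umax : forall x, (forall y, U y -> b x y = 0) -> U x.

Local Notation W := (rho_image c g0 U).

Lemma rho_image0 : W 0.
Proof. by exists 0 => //; rewrite linear0 mulr0 mul0r. Qed.

Lemma rho_imageD t x y : W x -> W y -> W (t *: x + y).
Proof.
move=> [u Uu ru] [v Uv rv]; exists (t *: u + v); first exact: UD.
by rewrite !linearP /= ru rv mulrDr mulrDl scalerAl -scalerAr.
Qed.

Lemma rho_image_isotropic x y : W x -> W y -> b x y = 0.
Proof.
by move=> [u Uu ru] [v Uv rv]; rewrite (rot_isometry ru rv) Uiso.
Qed.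

Lemma rho_image_maximal x : (forall y, W y -> b x y = 0) -> W x.
Proof.
move=> h; have [v rv] := rot_surj x; exists v => //.
apply: Umax => u Uu; have [w rw] := rot_ex u.
by rewrite -(rot_isometry rv rw); apply: h; exists u.
Qed.

End CliffordRotation.

(** * The Lagrangian H^1(X^) (x) K *)

Section RationalRepresentation.
Variables (F : comPzRingType) (m : nat) (e : {rmorphism F -> 'M[rat]_m}).

Definition rep_V (a : F) : 'M[rat]_(m + m) := block_mx (e a) 0 0 (e a)^T.

Lemma act_VE a (v : 'rV[rat]_(m + m)) : act_V (e a) v = v *m rep_V a.
Proof.
rewrite /act_V -[in RHS](hsubmxK v) /rep_V mul_row_block.
by rewrite !mulmx0 addr0 add0r.
Qed.

Lemma rep_V_zmod : zmod_morphism rep_V.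
Proof.
move=> a b; rewrite /rep_V raddfB /= opp_block_mx add_block_mx !oppr0 !addr0.
by rewrite linearB.
Qed.

Lemma rep_V_monoid : monoid_morphism rep_V.
Proof.
split=> [|a b]; rewrite /rep_V.
  by rewrite rmorph1 trmx1 -scalar_mx_block.
rewrite [RHS]mulmx_block !mulmx0 !mul0mx !addr0 !add0r -trmx_mul.
by rewrite rmorphM /=; congr block_mx; rewrite -rmorphM mulrC rmorphM.
Qed.

HB.instance Definition _ := GRing.isZmodMorphism.Build _ _ rep_V rep_V_zmod.
HB.instance Definition _ := GRing.isMonoidMorphism.Build _ _ rep_V rep_V_monoid.

Lemma dual_rep_V a theta : (row_mx 0 theta : 'rV_(m + m)) *m rep_V a =
  row_mx 0 (theta *m (e a)^T).
Proof. by rewrite mul_row_block !mul0mx mulmx0 !add0r. Qed.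

End RationalRepresentation.

Lemma pairing_V_dual (L : fieldType) m (v : 'rV[L]_(m + m)) (theta : 'rV[L]_m) :
  pairing_V v (row_mx 0 theta) = (theta *m (lsubmx v)^T) 0 0.
Proof. by rewrite /pairing_V row_mxKl row_mxKr trmx0 mulmx0 add0r. Qed.

Section DualLagrangian.
Variables (K : fieldExtType rat) (F : {subfield K}) (iota : {rmorphism K -> K}).
Hypothesis iotaF : forall a, a \in F -> iota a = a.
Variable zeta : K.
Hypothesis zeta0 : zeta != 0.
Hypothesis iota_zeta : iota zeta = - zeta.
Hypothesis zeta_gen : forall x, exists a b : subvs_of F, x = vsval a + vsval b * zeta.
Variable delta : subvs_of F.
Hypothesis zeta2 : vsval delta = zeta ^+ 2.
Variables (m : nat) (e : {rmorphism subvs_of F -> 'M[rat]_m}).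
Local Notation V := 'rV[rat]_(m + m).
Variable bF : V -> V -> subvs_of F.
Hypothesis hbF : is_F_pairing (fun a v => v *m rep_V e a) bF.
Variables (VK : lmodType K) (j : {additive V -> VK}).
Hypothesis hVK : is_scalar_extension (fun a v => v *m rep_V e a) j.
Variable bK : VK -> VK -> K.
Hypothesis hbK : is_K_pairing bF j bK.
Local Notation U := (H1dual_K j).

Lemma H1dual_linear t x y : U x -> U y -> U (t *: x + y).
Proof. by move=> Ux Uy; apply: lin_spanD => //; apply: lin_spanZ. Qed.

Lemma H1dual_isotropic x y : U x -> U y -> bK x y = 0.
Proof.
have [bKDl bKDr bKZl bKZr bKj] := hbK.
have bK0l z : bK 0 z = 0 by rewrite -(scale0r 0) bKZl mul0r.
have bK0r z : bK z 0 = 0 by rewrite -(scale0r 0) bKZr mul0r.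
move=> Ux Uy; elim/lin_span_ind: Ux; first exact: bK0l.
  by move=> a z z' z0 z0'; rewrite bKDl bKZl z0 z0' mulr0 addr0.
move=> _ [theta _ <-]; elim/lin_span_ind: Uy; first exact: bK0r.
  by move=> a z z' z0 z0'; rewrite bKDr bKZr z0 z0' mulr0 addr0.
move=> _ [theta' _ <-]; rewrite bKj (bF_eq0 hbF) ?linear0 // => a.
by rewrite dual_rep_V pairing_V_dual row_mxKl trmx0 mulmx0 mxE.
Qed.

Lemma H1dual_maximal x : (forall y, U y -> bK x y = 0) -> U x.
Proof.
have [bKDl bKDr bKZl bKZr bKj] := hbK.
have [a [b ->]] := VK_split zeta_gen zeta2 hVK x => h.
(* By independence of 1 and zeta, x = j a + zeta (j b) is orthogonal to the dual
   vectors only if a and b are. *)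
have ab theta : bF a (row_mx 0 theta) = 0 /\ bF b (row_mx 0 theta) = 0.
  apply: (zeta_indep iotaF zeta0 iota_zeta).
  rewrite -(h (j (row_mx 0 theta))) ?bKDl ?bKZl ?bKj //.
  by apply: lin_span_sub; exists theta.
have dual v : (forall theta, bF v (row_mx 0 theta) = 0) -> U (j v).
  move=> v0; apply: lin_span_sub; exists (rsubmx v) => //; congr (j _).
  rewrite -[RHS](hsubmxK v); congr row_mx; apply/esym/rowP => i.
  have := congr1 (@field_trace _) (v0 (delta_mx 0 i)).
  case: hbF => _ _ _ ->; rewrite pairing_V_dual field_trace0 -rowE !mxE => vi.
  by rewrite vi.
by rewrite addrC; apply: H1dual_linear; apply: dual => theta; case: (ab theta).
Qed.

End DualLagrangian.

(** * Projectors onto the places of F *)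

Section Projectors.
Variables (L : fieldExtType rat) (C : numClosedFieldType).
Variable s : 'I_(\dim {:L}) -> {rmorphism L -> C}.
Hypothesis sU : embedding_mx (fun i => s i) \in unitmx.
Local Notation Y := (invmx (embedding_mx (fun i => s i))).
Local Notation b := (vbasis {:L}).

Lemma embedding_independent (M : lmodType C) (x : 'I_(\dim {:L}) -> M) :
  (forall a, \sum_i s i a *: x i = 0) -> forall i, x i = 0.
Proof.
move=> h i; transitivity (\sum_(k < \dim {:L}) Y k i *: \sum_j s j b`_k *: x j).
  under eq_bigr do rewrite scaler_sumr.
  rewrite exchange_big /= (bigD1 i) //= [X in _ + X]big1 ?addr0 => [|j ji].
    under eq_bigr do rewrite scalerA mulrC.
    by rewrite -scaler_suml (sum_embedding_dual sU) eqxx scale1r.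
  under eq_bigr do rewrite scalerA mulrC.
  by rewrite -scaler_suml (sum_embedding_dual sU) (negPf ji) scale0r.
by rewrite big1 // => k _; rewrite h scaler0.
Qed.

Lemma embedding_distinct i k : i != k -> exists a, s i a != s k a.
Proof.
move=> ik; apply: contrapT => /forallNP h.
pose x j : C^o := if j == i then 1 else if j == k then -1 else 0.
have : x i = 0.
  apply: embedding_independent => a.
  rewrite (bigD1 i) //= (bigD1 k) 1?eq_sym //= big1 => [|l /andP[li lk]].
    rewrite addr0 /x eqxx eq_sym (negPf ik) eqxx scalerN -scalerBl.
    by have /negP/negPn/eqP -> := h a; rewrite subrr scale0r.
  by rewrite /x (negPf li) (negPf lk) scaler0.
by move/eqP; rewrite /x eqxx oner_eq0.
Qed.

(** Expand t in the embeddings; multiplicativity of t and linear independence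
    force every embedding with a nonzero coefficient to equal t. *)
Lemma embedding_complete (t : {rmorphism L -> C}) : exists i, s i =1 t.
Proof.
pose c i : C^o := \sum_(k < \dim {:L}) Y k i *: (t b`_k : C^o).
have tE a : t a = \sum_i s i a *: c i := embedding_expansion sU (t : {additive L -> C^o}) a.
have [i ci] : exists i, c i != 0.
  apply: contrapT => /forallNP h; have := tE 1; rewrite rmorph1 big1 => [/eqP|i _].
    by rewrite oner_eq0.
  by have /negP/negPn/eqP -> := h i; rewrite scaler0.
exists i => a; apply: (mulIf ci); apply/eqP; rewrite -subr_eq0 -mulrBl; apply/eqP.
apply: (embedding_independent (x := fun i => (s i a - t a) * c i : C^o)) => a'.
transitivity (t (a * a') - t a * t a'); last by rewrite rmorphM subrr.
rewrite !tE mulr_sumr -sumrB; apply: eq_bigr => k _.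
by rewrite rmorphM /GRing.scale /=; ring.
Qed.

Variables (N : nat) (rho : {rmorphism L -> 'M[rat]_N}).
Definition rhoC (a : L) : 'M[C]_N := map_mx ratr (rho a).

Lemma rhoC_zmod : zmod_morphism rhoC.
Proof. by move=> a a'; rewrite /rhoC raddfB map_mxB. Qed.
HB.instance Definition _ := GRing.isZmodMorphism.Build _ _ rhoC rhoC_zmod.

Lemma rhoCM a a' : rhoC (a * a') = rhoC a *m rhoC a'.
Proof. by rewrite /rhoC rmorphM map_mxM. Qed.

Lemma rhoC1 : rhoC 1 = 1%:M.
Proof. by rewrite /rhoC rmorph1 map_mx1. Qed.

Lemma rhoC_comm a a' : rhoC a *m rhoC a' = rhoC a' *m rhoC a.
Proof. by rewrite -!rhoCM mulrC. Qed.

(** The idempotent of L (x) C attached to the i-th embedding, acting through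
    rho. *)
Definition proj_mx_at i : 'M[C]_N := \sum_(k < \dim {:L}) Y k i *: rhoC b`_k.
Local Notation P := proj_mx_at.

Lemma rhoC_expansion a : rhoC a = \sum_i s i a *: P i.
Proof. exact: (embedding_expansion sU (rhoC : {additive L -> 'M[C]_N})). Qed.

Lemma sum_proj : \sum_i P i = 1%:M.
Proof.
by rewrite -rhoC1 rhoC_expansion; apply: eq_bigr => i _; rewrite rmorph1 scale1r.
Qed.

(** Compare the coefficients of the embeddings of a' in rho(a') rho(a) =
    rho(a' a). *)
Lemma proj_eigen i a : P i *m rhoC a = s i a *: P i.
Proof.
apply/eqP; rewrite -subr_eq0; apply/eqP; move: i.
apply: embedding_independent => a'.
transitivity (rhoC a' *m rhoC a - rhoC (a' * a)); last by rewrite rhoCM subrr.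
rewrite (rhoC_expansion a') (rhoC_expansion (a' * a)) mulmx_suml -sumrB.
by apply: eq_bigr => i _; rewrite -scalemxAl rmorphM scalerBr scalerA.
Qed.

Lemma proj_commute (A : 'M[C]_N) i :
  (forall a, rhoC a *m A = A *m rhoC a) -> P i *m A = A *m P i.
Proof.
move=> h; rewrite mulmx_suml mulmx_sumr; apply: eq_bigr => k _.
by rewrite -scalemxAl -scalemxAr h.
Qed.

Lemma proj_id i (x : 'rV[C]_N) : (forall a, x *m rhoC a = s i a *: x) -> x *m P i = x.
Proof.
move=> h; rewrite mulmx_sumr.
under eq_bigr do rewrite -scalemxAr h scalerA mulrC.
by rewrite -scaler_suml (sum_embedding_dual sU) eqxx scale1r.
Qed.

End Projectors.

(** * Tensors acting on spinors *)

Section TensorAction.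
Variables (C : fieldType) (m : nat).
Implicit Types (M : 'M[C]_(m + m)) (y : Hstar m C).
Local Notation x_ k := (delta_mx 0 k : 'rV[C]_(m + m)).

Lemma row_delta_sum (Q : 'M[C]_(m + m)) k : row k Q = \sum_l Q k l *: x_ l.
Proof.
by rewrite [LHS]row_sum_delta; apply: eq_bigr => l _; rewrite mxE.
Qed.

(** A matrix M stands for the tensor sum_k x_k (x) (row k M), where (x_k) is the
    standard basis; it acts through the product in the Clifford algebra. *)
Definition tensor_act M y : Hstar m C :=
  \sum_k spin_act (x_ k) (spin_act (row k M) y).

Definition tensor_trace M : C := \sum_k pairing_V (x_ k) (row k M).

Lemma spin_act0l y : spin_act (0 : 'rV[C]_(m + m)) y = 0.
Proof. by rewrite -(scale0r 0) spin_actZl scale0r. Qed.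

Lemma tensor_act_linear y : linear (tensor_act^~ y).
Proof.
move=> a M N; rewrite /tensor_act scaler_sumr -big_split; apply: eq_bigr => k _.
by rewrite !linearP /= spin_actDl spin_actZl linearP.
Qed.

Lemma tensor_trace_linear : linear (tensor_trace : 'M[C]_(m + m) -> C^o).
Proof.
move=> a M N; rewrite /tensor_trace scaler_sumr -big_split; apply: eq_bigr => k _.
by rewrite linearP /= pairing_VDr pairing_VZr.
Qed.
HB.instance Definition _ := GRing.isLinear.Build C _ C^o _ tensor_trace tensor_trace_linear.

Lemma tensor_actD M N y : tensor_act (M + N) y = tensor_act M y + tensor_act N y.
Proof. by rewrite -[M in LHS]scale1r tensor_act_linear scale1r. Qed.

Lemma tensor_act0 y : tensor_act 0 y = 0.
Proof.
by rewrite /tensor_act big1 // => k _; rewrite row0 spin_act0l linear0.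
Qed.

Lemma tensor_actZ a M y : tensor_act (a *: M) y = a *: tensor_act M y.
Proof. by rewrite -[a *: M]addr0 tensor_act_linear tensor_act0 addr0. Qed.

Lemma tensor_act_suml (I : finType) (M : I -> 'M[C]_(m + m)) y :
  tensor_act (\sum_i M i) y = \sum_i tensor_act (M i) y.
Proof.
apply: (big_ind2 (fun A B => tensor_act A y = B)) => [|A _ B _ <- <-|//].
  exact: tensor_act0.
exact: tensor_actD.
Qed.

Lemma tensor_act_sumr (I : finType) M (y : I -> Hstar m C) (c : I -> C) :
  tensor_act M (\sum_i c i *: y i) = \sum_i c i *: tensor_act M (y i).
Proof.
rewrite /tensor_act; under [RHS]eq_bigr do rewrite scaler_sumr.
rewrite exchange_big; apply: eq_bigr => k _ /=.
by rewrite !linear_sum; apply: eq_bigr => i _; rewrite !linearZZ.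
Qed.

(** Q^T M is the tensor obtained by applying Q to the left factors of M. *)
Lemma tensor_act_mul Q M y :
  tensor_act (Q^T *m M) y = \sum_k spin_act (row k Q) (spin_act (row k M) y).
Proof.
rewrite /tensor_act.
have rQ k : row k Q = \sum_l Q k l *: x_ l := row_delta_sum Q k.
under [RHS]eq_bigr => k _.
  rewrite rQ spin_act_suml; under eq_bigr do rewrite spin_actZl.
  over.
rewrite exchange_big; apply: eq_bigr => l _ /=.
have -> : row l (Q^T *m M) = \sum_k Q k l *: row k M.
  rewrite row_mul mulmx_sum_row; apply: eq_bigr => k _.
  by rewrite !mxE.
rewrite spin_act_suml linear_sum; apply: eq_bigr => k _.
by rewrite spin_actZl linearZZ.
Qed.

Lemma tensor_trace_mul Q M :
  tensor_trace (Q^T *m M) = \sum_k pairing_V (row k Q) (row k M).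
Proof.
rewrite /tensor_trace.
have rQ k : row k Q = \sum_l Q k l *: x_ l := row_delta_sum Q k.
under [RHS]eq_bigr => k _.
  rewrite rQ pairing_V_suml; under eq_bigr do rewrite pairing_VZl.
  over.
rewrite exchange_big; apply: eq_bigr => l _ /=.
have -> : row l (Q^T *m M) = \sum_k Q k l *: row k M.
  rewrite row_mul mulmx_sum_row; apply: eq_bigr => k _.
  by rewrite !mxE.
rewrite pairing_VC pairing_V_suml; apply: eq_bigr => k _.
by rewrite pairing_VZl pairing_VC.
Qed.

Lemma tensor_act_rank1 (u v : 'rV[C]_(m + m)) y :
  tensor_act (u^T *m v) y = spin_act u (spin_act v y).
Proof.
rewrite /tensor_act {2}(row_sum_delta u) spin_act_suml; apply: eq_bigr => k _.
rewrite spin_actZl -linearZZ -spin_actZl; congr (spin_act _ (spin_act _ _)).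
by apply/rowP => l; rewrite !mxE big_ord1 !mxE.
Qed.

Lemma tensor_trace_rank1 (u v : 'rV[C]_(m + m)) :
  tensor_trace (u^T *m v) = pairing_V u v.
Proof.
rewrite /tensor_trace {2}(row_sum_delta u) pairing_V_suml; apply: eq_bigr => k _.
rewrite pairing_VZl -pairing_VZr; congr (pairing_V _ _).
by apply/rowP => l; rewrite !mxE big_ord1 !mxE.
Qed.

End TensorAction.

Section RationalTensors.
Variables (C : numFieldType) (m : nat).
Local Notation ratM := (map_mx (ratr : rat -> C)).

Lemma pairing_V_ratr (u v : 'rV[rat]_(m + m)) :
  pairing_V (ratM u) (ratM v) = ratr (pairing_V u v).
Proof.
rewrite !pairing_VE rmorph_sum; apply: eq_bigr => i _.
by rewrite rmorphD !rmorphM !mxE.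
Qed.

Lemma spin_act_ratr (v : 'rV[rat]_(m + m)) (y : Hstar m rat) :
  spin_act (ratM v) (Hstar_ratr C y) = Hstar_ratr C (spin_act v y).
Proof.
apply/ffunP => S; rewrite [RHS]ffunE !spin_actE rmorph_sum; apply: eq_bigr => i _.
rewrite !rmorphM /= ffunE; congr (_ * _ * _).
  by rewrite /eps rmorphXn rmorphN1.
by rewrite /flip_coord; case: ifP => _; rewrite mxE.
Qed.

Lemma Hstar_ratr_sum (I : finType) (y : I -> Hstar m rat) :
  Hstar_ratr C (\sum_i y i) = \sum_i Hstar_ratr C (y i).
Proof.
apply/ffunP => S; rewrite ffunE !sum_ffunE rmorph_sum.
by apply: eq_bigr => i _; rewrite ffunE.
Qed.

Lemma tensor_act_ratr (M : 'M[rat]_(m + m)) (y : Hstar m rat) :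
  tensor_act (ratM M) (Hstar_ratr C y) = Hstar_ratr C (tensor_act M y).
Proof.
rewrite Hstar_ratr_sum; apply: eq_bigr => k _.
by rewrite -!spin_act_ratr map_row map_delta_mx.
Qed.

Lemma tensor_trace_ratr (M : 'M[rat]_(m + m)) :
  tensor_trace (ratM M) = ratr (tensor_trace M).
Proof.
rewrite /tensor_trace rmorph_sum /=; apply: eq_bigr => k _.
by rewrite -pairing_V_ratr map_row map_delta_mx.
Qed.

End RationalTensors.

(** * Special tensors and the eigenspaces of K *)

(** The Lie algebra of the special unitary group of the hermitian K-space V,
    inside V (x) V acting on spinors.  The conditions for eta(t) follow from
    those for the action rho of F and for Z = eta(zeta); the last two say that
    the component of M in each V_sigma (x) V_sigma' has trace zero. *)
Definition special_tensor (A : Type) (E : fieldType) (m : nat)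
    (rho : A -> 'M[E]_(m + m)) (Z M : 'M[E]_(m + m)) : Prop :=
  [/\ forall a, (rho a)^T *m M = M *m rho a,
      Z^T *m M = - (M *m Z),
      forall a, tensor_trace ((rho a)^T *m M) = 0
    & forall a, tensor_trace ((rho a)^T *m (Z^T *m M)) = 0].

Section Eigenspaces.
Variables (L : fieldExtType rat) (C : numClosedFieldType).
Variable s : 'I_(\dim {:L}) -> {rmorphism L -> C}.
Hypothesis sU : embedding_mx (fun i => s i) \in unitmx.
Variables (m : nat) (rho : {rmorphism L -> 'M[rat]_(m + m)}).
Variables (Z : 'M[rat]_(m + m)) (delta : L).
Hypothesis delta0 : delta != 0.
Hypothesis ZZ : Z *m Z = rho delta.
Hypothesis rhoZ : forall a, rho a *m Z = Z *m rho a.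
Hypothesis adj_rho : forall a u v, pairing_V (u *m rho a) v = pairing_V u (v *m rho a).
Hypothesis adj_Z : forall u v, pairing_V (u *m Z) v = - pairing_V u (v *m Z).

Local Notation rhoC := (rhoC C rho).
Local Notation P := (proj_mx_at s rho).
Local Notation ratM := (map_mx (ratr : rat -> C)).
Local Notation ZC := (ratM Z).
Local Notation J := (pairing_mx C m).

Lemma mx_pairing (E : fieldType) (A B : 'M[E]_(m + m)) :
  (forall u v, pairing_V (u *m A) v = pairing_V u (v *m B)) <->
  A *m pairing_mx E m = pairing_mx E m *m B^T.
Proof.
split=> [h|AB u v]; last first.
  by rewrite !pairing_VJ trmx_mul -(mulmxA u A) AB !mulmxA.
apply/matrixP => i k; have := h (delta_mx 0 i) (delta_mx 0 k).
rewrite !pairing_VJ !trmx_mul !trmx_delta !mulmxA -!colE -!mulmxA -!rowE.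
by rewrite !mxE.
Qed.

Lemma pairing_mx_ratr : ratM (pairing_mx rat m) = J.
Proof. by rewrite map_block_mx !map_mx0 !map_mx1. Qed.

Lemma pairing_rhoC a u v : pairing_V (u *m rhoC a) v = pairing_V u (v *m rhoC a).
Proof.
move: u v; apply/(mx_pairing (rhoC a) (rhoC a)).
have /mx_pairing AJ := adj_rho a.
by rewrite map_trmx -pairing_mx_ratr -!map_mxM AJ.
Qed.

Lemma pairing_ZC u v : pairing_V (u *m ZC) v = - pairing_V u (v *m ZC).
Proof.
rewrite -mulN1r -pairing_VZr scaleN1r -mulmxN; move: u v.
apply/(mx_pairing ZC (- ZC)).
have adjN u v : pairing_V (u *m Z) v = pairing_V u (v *m - Z).
  by rewrite adj_Z mulmxN -[- (v *m Z)]scaleN1r pairing_VZr mulN1r.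
have /mx_pairing AJ := adjN.
by rewrite -map_mxN map_trmx -pairing_mx_ratr -!map_mxM AJ.
Qed.

(** The subspace V_sigma for the embedding sigma that restricts to the i-th
    embedding of F and sends zeta to w. *)
Definition eigen i (w : C) (x : 'rV[C]_(m + m)) : Prop :=
  (forall a, x *m rhoC a = s i a *: x) /\ x *m ZC = w *: x.

Lemma eigenZ i w a x : eigen i w x -> eigen i w (a *: x).
Proof.
move=> [hr hz]; split=> [a'|].
  by rewrite -scalemxAl hr !scalerA mulrC.
by rewrite -scalemxAl hz !scalerA mulrC.
Qed.

(** rho(a) is self-adjoint and Z is anti-self-adjoint. *)
Lemma eigen_orthogonal i w x i' w' x' : eigen i w x -> eigen i' w' x' ->
  (i != i') || (w + w' != 0) -> pairing_V x x' = 0.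
Proof.
move=> [xr xz] [x'r x'z]; case: eqVneq => /= [_ ww'|ii' _].
  have := pairing_ZC x x'; rewrite xz x'z pairing_VZl pairing_VZr => /eqP.
  by rewrite -addr_eq0 -mulrDl mulf_eq0 (negPf ww') => /eqP.
have [a sa] := embedding_distinct sU ii'.
have := pairing_rhoC a x x'; rewrite xr x'r pairing_VZl pairing_VZr => /eqP.
by rewrite -subr_eq0 -mulrBl mulf_eq0 subr_eq0 (negPf sa) => /eqP.
Qed.

(** Z acts on the image of P i with the eigenvalues w and - w. *)
Definition eigenproj i (w : C) : 'M[C]_(m + m) :=
  P i *m (2%:R^-1 *: (1%:M + w^-1 *: ZC)).
Local Notation Q := eigenproj.

Let two_neq0 : 2%:R != 0 :> C. Proof. by rewrite pnatr_eq0. Qed.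

Lemma rhoC_ZC a : rhoC a *m ZC = ZC *m rhoC a.
Proof. by rewrite /rhoC -!map_mxM rhoZ. Qed.

Lemma ZC_ZC : ZC *m ZC = rhoC delta.
Proof. by rewrite -map_mxM ZZ. Qed.

Lemma proj_ZC i : P i *m ZC = ZC *m P i.
Proof. by apply: proj_commute => a; apply: rhoC_ZC. Qed.

Lemma eigenproj_eigen i w x : w ^+ 2 = s i delta -> w != 0 ->
  eigen i w (x *m Q i w).
Proof.
move=> w2 w0; split=> [a|].
  have comm : (2%:R^-1 *: (1%:M + w^-1 *: ZC)) *m rhoC a =
      rhoC a *m (2%:R^-1 *: (1%:M + w^-1 *: ZC)).
    rewrite -scalemxAl -scalemxAr mulmxDl mulmxDr mul1mx mulmx1.
    by rewrite -scalemxAl -scalemxAr rhoC_ZC.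
  rewrite -mulmxA -[Q i w *m _]mulmxA comm (mulmxA (P i)) (proj_eigen sU).
  by rewrite -!scalemxAl -scalemxAr.
have PZ : P i *m (1%:M + w^-1 *: ZC) *m ZC = w *: (P i *m (1%:M + w^-1 *: ZC)).
  rewrite mulmxDr mulmx1 -scalemxAr mulmxDl -scalemxAl -mulmxA ZC_ZC.
  rewrite (proj_eigen sU) scalerDr !scalerA -w2 expr2 mulrA mulVf // divff //.
  by rewrite mul1r scale1r addrC.
by rewrite -mulmxA /Q -scalemxAr -scalemxAl PZ scalerA mulrC -scalerA -scalemxAr.
Qed.

Lemma eigen_eigenproj i w x : w != 0 -> eigen i w x -> x *m Q i w = x.
Proof.
move=> w0 [xr xz]; rewrite mulmxA (proj_id sU xr) -scalemxAr mulmxDr mulmx1.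
rewrite -scalemxAr xz scalerA mulVf // scale1r -mulr2n -[x *+ 2]scaler_nat.
by rewrite scalerA mulVf ?scale1r.
Qed.

Lemma eigenproj_idem i w : w ^+ 2 = s i delta -> w != 0 -> Q i w *m Q i w = Q i w.
Proof.
move=> w2 w0; apply/row_matrixP => k; rewrite row_mul eigen_eigenproj //.
by rewrite rowE; apply: eigenproj_eigen.
Qed.

Lemma eigenproj_sum i w : P i = Q i w + Q i (- w).
Proof.
rewrite /Q -mulmxDr -scalerDr invrN scaleNr addrACA subrr addr0.
rewrite -mulr2n -[1%:M *+ 2]scaler_nat scalerA mulVf // scale1r.
by rewrite mulmx1.
Qed.

Let half_tr w : (2%:R^-1 *: (1%:M + w^-1 *: ZC))^T =
  2%:R^-1 *: (1%:M + w^-1 *: ZC^T).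
Proof. by apply/matrixP => a b; rewrite !mxE eq_sym. Qed.

Section Special.
Variable M : 'M[C]_(m + m).
Hypothesis Msp : special_tensor rhoC ZC M.

(** A special tensor has no component in V_sigma (x) V_tau unless tau is
    conjugate to sigma. *)
Lemma special_eigenproj i w : (Q i w)^T *m M = M *m Q i (- w).
Proof.
case: Msp => Mr MZ _ _.
have MP : (P i)^T *m M = M *m P i.
  rewrite linear_sum mulmx_suml mulmx_sumr; apply: eq_bigr => k _.
  by rewrite linearZ -scalemxAl -scalemxAr Mr.
have MPZ : ZC^T *m (M *m P i) = - (M *m P i *m ZC).
  by rewrite mulmxA MZ mulNmx -!mulmxA proj_ZC.
rewrite /Q trmx_mul half_tr -mulmxA MP (mulmxA M); move: (M *m P i) MPZ => N MPZ.
rewrite -scalemxAl -scalemxAr mulmxDl mulmxDr mul1mx mulmx1.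
by rewrite -scalemxAl -scalemxAr MPZ invrN scaleNr scalerN.
Qed.

Lemma special_trace i w : tensor_trace ((Q i w)^T *m M) = 0.
Proof.
case: Msp => _ _ Mt MtZ.
have PA A : (forall a, tensor_trace ((rhoC a)^T *m A) = 0) ->
    tensor_trace ((P i)^T *m A) = 0.
  move=> h; rewrite linear_sum mulmx_suml linear_sum big1 // => k _.
  by rewrite linearZ -scalemxAl linearZ /= h scaler0.
have comm : (Q i w)^T = (P i)^T *m (2%:R^-1 *: (1%:M + w^-1 *: ZC^T)).
  have -> : Q i w = (2%:R^-1 *: (1%:M + w^-1 *: ZC)) *m P i.
    rewrite /Q -scalemxAl -scalemxAr mulmxDl mulmxDr mul1mx mulmx1.
    by rewrite -scalemxAl -scalemxAr proj_ZC.
  by rewrite trmx_mul half_tr.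
rewrite comm -mulmxA -scalemxAl mulmxDl mul1mx -scalemxAl -scalemxAr mulmxDr.
rewrite linearZ linearD /= PA // -scalemxAr linearZ /= PA //.
by rewrite scaler0 addr0 scaler0.
Qed.

(** The choice w i of a square root of delta at each place encodes a CM-type. *)
Definition killed (w : 'I_(\dim {:L}) -> C) (y : Hstar m C) : Prop :=
  forall i x, eigen i (w i) x -> spin_act x y = 0.

(** Decompose M by applying to its left factors the projectors onto all the
    eigenspaces.  In the component of V_(- w i) the right factor kills y.  In
    that of V_(w i) the left factor kills y, so commuting the two factors
    leaves only the trace, which vanishes. *)
Lemma special_kills w y : (forall i, w i ^+ 2 = s i delta) -> killed w y ->
  tensor_act M y = 0.
Proof.
move=> w2 wy; have w0 i : w i != 0 by rewrite -sqrf_eq0 w2 fmorph_eq0.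
have part i v : v ^+ 2 = s i delta -> (Q i v)^T *m M = (Q i v)^T *m (M *m Q i (- v)).
  move=> v2; rewrite -special_eigenproj mulmxA -trmx_mul eigenproj_idem //.
  by rewrite -sqrf_eq0 v2 fmorph_eq0.
have -> : M = \sum_i ((Q i (w i))^T *m M + (Q i (- w i))^T *m M).
  rewrite -[LHS]mul1mx -trmx1 -(sum_proj sU rho) linear_sum mulmx_suml.
  by apply: eq_bigr => i _; rewrite (eigenproj_sum i (w i)) linearD mulmxDl.
rewrite tensor_act_suml big1 // => i _; rewrite tensor_actD.
have wN2 : (- w i) ^+ 2 = s i delta by rewrite sqrrN.
rewrite (part i (- w i)) // opprK (tensor_act_mul (Q i (- w i))) [X in _ + X]big1 ?addr0; last first.
  move=> k _; rewrite (row_mul k M) (wy i) ?linear0 //.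
  by apply: eigenproj_eigen.
have kQ k : spin_act (row k (Q i (w i))) y = 0.
  by apply: (wy i); rewrite rowE; apply: eigenproj_eigen.
rewrite part // tensor_act_mul.
under eq_bigr => k _.
  rewrite -[spin_act _ _]addr0 -(linear0 (spin_act (row k (M *m Q i (- w i))))).
  rewrite -(kQ k) spin_act_clifford.
  over.
by rewrite -scaler_suml -tensor_trace_mul -part // special_trace scale0r.
Qed.

End Special.

(** These tensors span sl(V_sigma). *)
Lemma special_rank1 i w (u1 u1' u u' : 'rV[C]_(m + m)) :
  eigen i w u1 -> eigen i (- w) u1' -> eigen i w u -> eigen i (- w) u' ->
  pairing_V u1 u1' = 1 ->
  special_tensor rhoC ZC (u^T *m u' - pairing_V u u' *: (u1^T *m u1')).
Proof.
move=> e1 e1' e e' u11.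
have mr v v' a : eigen i w v -> eigen i (- w) v' ->
    (rhoC a)^T *m (v^T *m v') = s i a *: (v^T *m v').
  by move=> [vr _] _; rewrite mulmxA -trmx_mul vr linearZ -scalemxAl.
have mZ v v' : eigen i w v -> eigen i (- w) v' ->
    ZC^T *m (v^T *m v') = w *: (v^T *m v').
  by move=> [_ vz] _; rewrite mulmxA -trmx_mul vz linearZ -scalemxAl.
have mr' v v' a : eigen i w v -> eigen i (- w) v' ->
    (v^T *m v') *m rhoC a = s i a *: (v^T *m v').
  by move=> _ [vr _]; rewrite -mulmxA vr scalemxAr.
have mZ' v v' : eigen i w v -> eigen i (- w) v' ->
    (v^T *m v') *m ZC = - w *: (v^T *m v').
  by move=> _ [_ vz]; rewrite -mulmxA vz scalemxAr.
set M := _ - _.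
have Mr a : (rhoC a)^T *m M = s i a *: M.
  by rewrite mulmxBr -scalemxAr !mr // scalerBr !scalerA mulrC.
have MZ : ZC^T *m M = w *: M.
  by rewrite mulmxBr -scalemxAr !mZ // scalerBr !scalerA mulrC.
have Mt : tensor_trace M = 0.
  rewrite linearB linearZ /= !tensor_trace_rank1 u11.
  by rewrite /GRing.scale /= mulr1 subrr.
split=> [a||a|a].
- by rewrite Mr mulmxBl -scalemxAl !mr' // scalerBr !scalerA mulrC.
- rewrite MZ mulmxBl -scalemxAl !mZ' // !scaleNr scalerN opprB opprK scalerBr.
  by rewrite !scalerA mulrC addrC.
- by rewrite Mr linearZ /= Mt scaler0.
- by rewrite MZ -scalemxAr linearZ /= Mr linearZ /= Mt !scaler0.
Qed.


Hypothesis place_pairing : forall i, exists u v, pairing_V (u *m P i) v != 0.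

Lemma pairing_proj i u v : pairing_V (u *m P i) v = pairing_V u (v *m P i).
Proof.
rewrite !mulmx_sumr pairing_V_suml pairing_VC pairing_V_suml.
apply: eq_bigr => k _; rewrite -!scalemxAr !pairing_VZl.
by rewrite pairing_rhoC pairing_VC.
Qed.

(** The pairing is nonzero on the image of P i and couples only the two
    eigenspaces of Z. *)
Lemma dual_pair i w : w ^+ 2 = s i delta ->
  exists u u', [/\ eigen i w u, eigen i (- w) u' & pairing_V u u' = 1].
Proof.
move=> w2; have w0 : w != 0 by rewrite -sqrf_eq0 w2 fmorph_eq0.
have Nw2 : (- w) ^+ 2 = s i delta by rewrite sqrrN.
have Nw0 : - w != 0 by rewrite oppr_eq0.
suff [u [u' [eu eu' uu']]] :
    exists u u', [/\ eigen i w u, eigen i (- w) u' & pairing_V u u' != 0].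
  exists u, ((pairing_V u u')^-1 *: u'); split=> //; first exact: eigenZ.
  by rewrite pairing_VZr mulVf.
have [u [v]] := place_pairing i.
have -> : u *m P i = u *m P i *m P i.
  by rewrite [RHS](proj_id sU) // => a; rewrite -mulmxA (proj_eigen sU) scalemxAr.
rewrite pairing_proj !(eigenproj_sum i w) !mulmxDr !(pairing_VDl, pairing_VDr).
have eQ x : eigen i w (x *m Q i w) by apply: eigenproj_eigen.
have eQ' x : eigen i (- w) (x *m Q i (- w)) by apply: eigenproj_eigen.
have ww : (i != i) || (w + w != 0).
  by rewrite -mulr2n mulrn_eq0 negb_or w0 orbT.
have ww' : (i != i) || (- w + - w != 0).
  by rewrite -opprD oppr_eq0 -mulr2n mulrn_eq0 negb_or w0 orbT.
rewrite (eigen_orthogonal (eQ u) (eQ v) ww) add0r.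
rewrite (eigen_orthogonal (eQ' u) (eQ' v) ww') addr0.
case: (eqVneq (pairing_V (u *m Q i w) (v *m Q i (- w))) 0) => [uv|uv _].
  rewrite uv ?add0r ?addr0 => uv'.
  by exists (v *m Q i w), (u *m Q i (- w)); split=> //; rewrite pairing_VC.
by exists (u *m Q i w), (v *m Q i (- w)).
Qed.

Lemma spin_act_commute x p p' (y : Hstar m C) :
  pairing_V x p = 0 -> pairing_V x p' = 0 ->
  spin_act x (spin_act p (spin_act p' y)) = spin_act p (spin_act p' (spin_act x y)).
Proof.
move=> xp xp'; rewrite (spin_act_anticomm _ xp) (spin_act_anticomm _ xp').
by rewrite linearN opprK.
Qed.

(** Invariance under the special tensors of rank at most two: at each place the
    operators u u', normalised by the pairing, all act on y in the same way. *)
Definition balanced (z : 'I_(\dim {:L}) -> C) (y : Hstar m C) : Prop :=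
  forall i u u' u1 u1',
    eigen i (z i) u -> eigen i (- z i) u' -> eigen i (z i) u1 ->
    eigen i (- z i) u1' -> pairing_V u1 u1' = 1 ->
    spin_act u (spin_act u' y) = pairing_V u u' *: spin_act u1 (spin_act u1' y).

Section Splitting.
Variable z : 'I_(\dim {:L}) -> C.
Hypothesis z2 : forall i, z i ^+ 2 = s i delta.

Let z0 i : z i != 0. Proof. by rewrite -sqrf_eq0 z2 fmorph_eq0. Qed.

Lemma special_balanced y :
  (forall M, special_tensor rhoC ZC M -> tensor_act M y = 0) -> balanced z y.
Proof.
move=> h i u u' u1 u1' eu eu' eu1 eu1' p1.
have := h _ (special_rank1 eu1 eu1' eu eu' p1).
rewrite -scaleNr tensor_actD tensor_actZ !tensor_act_rank1 scaleNr => /eqP.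
by rewrite subr_eq0 => /eqP.
Qed.

Section Place.
Variables (i : 'I_(\dim {:L})) (p p' : 'rV[C]_(m + m)).
Hypothesis ep : eigen i (z i) p.
Hypothesis ep' : eigen i (- z i) p'.
Hypothesis pp' : pairing_V p p' = 1.
Variable y : Hstar m C.
Hypothesis bal : balanced z y.

Let eigen_sqr0 v x x' : eigen i v x -> eigen i v x' -> v != 0 ->
  pairing_V x x' = 0.
Proof.
move=> ex ex' v0; apply: (eigen_orthogonal ex ex').
by rewrite -mulr2n mulrn_eq0 v0 orbT.
Qed.

(** By balancedness x p' y is a multiple of p p' y, and p p = 0. *)
Lemma balanced_kill_pos x : eigen i (z i) x -> spin_act x (spin_act p (spin_act p' y)) = 0.
Proof.
move=> ex; rewrite (spin_act_anticomm _ (eigen_sqr0 ex ep (z0 i))).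
rewrite (bal ex ep' ep ep' pp') linearZ /=.
by rewrite (spin_actK _ (eigen_sqr0 ep ep (z0 i)) two_neq0) scaler0 oppr0.
Qed.

(** Likewise, since p' p y = y - p p' y. *)
Lemma balanced_kill_neg x : eigen i (- z i) x ->
  spin_act x (spin_act p' (spin_act p y)) = 0.
Proof.
have Nz0 : - z i != 0 by rewrite oppr_eq0.
move=> ex; rewrite (spin_act_anticomm _ (eigen_sqr0 ex ep' Nz0)).
have -> : spin_act x (spin_act p y) =
    pairing_V x p *: (y - spin_act p (spin_act p' y)).
  transitivity (pairing_V x p *: y - spin_act p (spin_act x y)).
    by apply/eqP; rewrite eq_sym subr_eq spin_act_clifford.
  by rewrite (bal ep ex ep ep' pp') (pairing_VC x) scalerBr.
have -> : y - spin_act p (spin_act p' y) = spin_act p' (spin_act p y).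
  by rewrite -[y in y - _]scale1r -pp' -spin_act_clifford addrC addKr.
by rewrite linearZ /= (spin_actK _ (eigen_sqr0 ep' ep' Nz0) two_neq0) scaler0 oppr0.
Qed.

Lemma balanced_pos : balanced z (spin_act p (spin_act p' y)).
Proof.
move=> k u u' u1 u1' eu eu' eu1 eu1' p1.
case: (eqVneq k i) => [ki|ki].
  rewrite {}ki in eu eu' eu1 eu1'.
  have uu' v v' : eigen i (z i) v -> eigen i (- z i) v' ->
      spin_act v (spin_act v' (spin_act p (spin_act p' y))) =
      pairing_V v v' *: spin_act p (spin_act p' y).
    by move=> ev ev'; rewrite -spin_act_clifford (balanced_kill_pos ev) linear0 addr0.
  by rewrite !uu' // p1 scale1r.
have orth v x x' v' : eigen k v x -> eigen i v' x' -> pairing_V x x' = 0.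
  by move=> ex ex'; apply: (eigen_orthogonal ex ex'); rewrite ki.
have comm v v' w w' : eigen k w v -> eigen k w' v' ->
    spin_act v (spin_act v' (spin_act p (spin_act p' y))) =
    spin_act p (spin_act p' (spin_act v (spin_act v' y))).
  move=> ev ev'; rewrite [spin_act v' _]spin_act_commute ?(orth _ _ _ _ ev' ep) ?(orth _ _ _ _ ev' ep') //.
  by rewrite spin_act_commute ?(orth _ _ _ _ ev ep) ?(orth _ _ _ _ ev ep').
rewrite (comm _ _ _ _ eu eu') (comm _ _ _ _ eu1 eu1').
by rewrite (bal eu eu' eu1 eu1' p1) !linearZ.
Qed.

Lemma balanced_neg : balanced z (spin_act p' (spin_act p y)).
Proof.
have -> : spin_act p' (spin_act p y) = y - spin_act p (spin_act p' y).
  by rewrite -[y in y - _]scale1r -pp' -spin_act_clifford addrC addKr.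
move=> k u u' u1 u1' eu eu' eu1 eu1' p1.
rewrite !linearB /= (bal eu eu' eu1 eu1' p1).
by rewrite (balanced_pos eu eu' eu1 eu1' p1).
Qed.

Lemma kill_other k v x : k != i -> eigen k v x -> spin_act x y = 0 ->
  spin_act x (spin_act p (spin_act p' y)) = 0 /\
  spin_act x (spin_act p' (spin_act p y)) = 0.
Proof.
move=> ki ex xy.
have xp : pairing_V x p = 0 by apply: (eigen_orthogonal ex ep); rewrite ki.
have xp' : pairing_V x p' = 0 by apply: (eigen_orthogonal ex ep'); rewrite ki.
by rewrite (spin_act_commute _ xp xp') (spin_act_commute _ xp' xp) xy !linear0.
Qed.

End Place.

(** Induction on the places at which y is not yet killed by one of the two
    eigenspaces: at such a place y = p p' y + p' p y, and both terms stay
    balanced and stay killed at the other places. *)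
Lemma balanced_span y : balanced z y ->
  lin_span [set y' | exists2 w, (forall i, w i ^+ 2 = s i delta) & killed w y'] y.
Proof.
pose kills y i v := v ^+ 2 = s i delta /\ forall x, eigen i v x -> spin_act x y = 0.
suff main (l : seq 'I_(\dim {:L})) : forall y, balanced z y ->
    (forall i, i \notin l -> exists v, kills y i v) ->
    lin_span [set y' | exists2 w, (forall i, w i ^+ 2 = s i delta) & killed w y'] y.
  by move=> bal; apply: (main (enum 'I_(\dim {:L}))) => // i; rewrite mem_enum.
elim: l => [|i l IH] {}y bal hy.
  apply: lin_span_sub.
  have [w wP] : exists w : 'I_(\dim {:L}) -> C, forall i, kills y i (w i).
    by have [w wP] := choice (fun i => hy i isT); exists w.
  by exists w => [i|i x]; case: (wP i) => // _; apply.
have [p [p' [ep ep' pp']]] := dual_pair (z2 i).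
rewrite -[y]scale1r -pp' -spin_act_clifford; apply: lin_spanD; apply: IH.
- exact: (balanced_pos ep ep' pp' bal).
- move=> k kl; case: (eqVneq k i) => [->|ki].
    exists (z i); split=> // x ex; exact: (balanced_kill_pos ep ep' pp' bal ex).
  have [v [v2 vk]] : exists v, kills y k v by apply: hy; rewrite inE negb_or ki.
  by exists v; split=> // x ex; case: (kill_other ep ep' ki ex (vk x ex)).
- exact: (balanced_neg ep ep' pp' bal).
- move=> k kl; case: (eqVneq k i) => [->|ki].
    exists (- z i); split=> [|x ex]; first by rewrite sqrrN.
    exact: (balanced_kill_neg ep ep' pp' bal ex).
  have [v [v2 vk]] : exists v, kills y k v by apply: hy; rewrite inE negb_or ki.
  by exists v; split=> // x ex; case: (kill_other ep ep' ki ex (vk x ex)).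
Qed.

End Splitting.

End Eigenspaces.

(** * Operators on spinors as an algebra over K *)

Section TwistedEnd.
Variables (K C : fieldType) (tau : {rmorphism K -> C}) (m : nat).

Lemma Hstar_proper : (0 < dim (Hstar m C))%N.
Proof. by rewrite /dim /= muln1; apply/card_gt0P; exists finset.set0. Qed.

(** The scalars of K act through tau, which must be visible in the type for the
    module structure to be inferred.  The universal property of the Clifford
    algebra over K then applies to operators on complex spinors. *)
Definition twisted_End (_ : {rmorphism K -> C}) : Type := 'End(Hstar m C).
Local Notation E := (twisted_End tau).

HB.instance Definition _ := GRing.Zmodule.on E.
HB.instance Definition _ := GRing.Zmodule_isNzRing.Build E
  (@comp_lfunA _ _ _ _ _) (@comp_lfun1l _ _ _) (@comp_lfun1r _ _ _)
  (@comp_lfunDl _ _ _ _) (@comp_lfunDr _ _ _ _) (lfun1_neq0 Hstar_proper).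

Definition twisted_scale (t : K) (f : E) : E := tau t *: (f : 'End(Hstar m C)).

Lemma twisted_scaleA a b (v : E) :
  twisted_scale a (twisted_scale b v) = twisted_scale (a * b) v.
Proof. by rewrite /twisted_scale scalerA rmorphM. Qed.
Lemma twisted_scale1 : left_id 1 twisted_scale.
Proof. by move=> v; rewrite /twisted_scale rmorph1 scale1r. Qed.
Lemma twisted_scaleDr : right_distributive twisted_scale +%R.
Proof. by move=> a u v; exact: scalerDr. Qed.
Lemma twisted_scaleDl v : {morph twisted_scale^~ v : a b / a + b}.
Proof. by move=> a b; rewrite /twisted_scale rmorphD scalerDl. Qed.

HB.instance Definition _ := GRing.Zmodule_isLmodule.Build K E
  twisted_scaleA twisted_scale1 twisted_scaleDr twisted_scaleDl.

Lemma twisted_scaleAl (a : K) (u v : E) : a *: (u * v) = (a *: u) * v.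
Proof. exact: comp_lfunZl. Qed.
Lemma twisted_scaleAr (a : K) (u v : E) : a *: (u * v) = u * (a *: v).
Proof. exact: comp_lfunZr. Qed.

HB.instance Definition _ := GRing.Lmodule_isLalgebra.Build K E twisted_scaleAl.
HB.instance Definition _ := GRing.Lalgebra_isAlgebra.Build K E twisted_scaleAr.

Definition ev (f : E) (y : Hstar m C) : Hstar m C := (f : 'End(Hstar m C)) y.

Lemma evD f g y : ev (f + g) y = ev f y + ev g y. Proof. exact: add_lfunE. Qed.
Lemma evM f g y : ev (f * g) y = ev f (ev g y). Proof. exact: comp_lfunE. Qed.
Lemma evZ t f y : ev (t *: f) y = tau t *: ev f y. Proof. exact: scale_lfunE. Qed.
Lemma ev1 y : ev 1 y = y. Proof. exact: id_lfunE. Qed.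
Lemma ev_linear f a y y' : ev f (a *: y + y') = a *: ev f y + ev f y'.
Proof. exact: linearP. Qed.
Lemma ev0 f : ev f 0 = 0. Proof. exact: linear0. Qed.
Lemma ev_ext f g : (forall y, ev f y = ev g y) -> f = g.
Proof. by move=> h; apply/lfunP. Qed.

Definition spin_op (v : 'rV[C]_(m + m)) : E := linfun (spin_act v).
Lemma spin_opE v y : ev (spin_op v) y = spin_act v y. Proof. exact: lfunE. Qed.

End TwistedEnd.

(** * Transporting spinors at a place of F *)

Section PlaceForm.
Variables (L : fieldExtType rat) (C : numClosedFieldType).
Variable s : 'I_(\dim {:L}) -> {rmorphism L -> C}.
Hypothesis sU : embedding_mx (fun i => s i) \in unitmx.
Variables (m : nat) (rho : {rmorphism L -> 'M[rat]_(m + m)}).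
Variable bF : 'rV[rat]_(m + m) -> 'rV[rat]_(m + m) -> L.
Hypothesis bFZ : forall a u v, bF (u *m rho a) v = a * bF u v.
Hypothesis bFtr : forall u v, field_trace (bF u v) = pairing_V u v.
Hypothesis adj_rho : forall a u v, pairing_V (u *m rho a) v = pairing_V u (v *m rho a).
Local Notation P := (proj_mx_at s rho).
Local Notation rhoC := (rhoC C rho).
Local Notation ratM := (map_mx (ratr : rat -> C)).

Lemma proj_idem i : P i *m P i = P i.
Proof.
apply/row_matrixP => k; rewrite (row_mul k (P i)) (proj_id sU) // => a.
by rewrite -row_mul (proj_eigen sU) linearZ.
Qed.

(** The pairing is the sum of the embeddings of the F-valued form; the projector
    P i isolates the i-th one. *)
Lemma pairing_place i u v : pairing_V (ratM u *m P i) (ratM v) = s i (bF u v).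
Proof.
rewrite mulmx_sumr pairing_V_suml.
have sb k : pairing_V (ratM u *m rhoC (vbasis {:L})`_k) (ratM v) =
    \sum_l s l (vbasis {:L})`_k * s l (bF u v).
  rewrite /rhoC -map_mxM pairing_V_ratr -bFtr bFZ (field_trace_embeddings sU).
  by apply: eq_bigr => l _; rewrite rmorphM.
under eq_bigr do rewrite -scalemxAr pairing_VZl sb mulr_sumr.
rewrite exchange_big (bigD1 i) //= [X in _ + X]big1 ?addr0 => [|l li].
  under eq_bigr do rewrite mulrCA mulrA.
  by rewrite -mulr_suml (sum_embedding_dual sU) eqxx mul1r.
under eq_bigr do rewrite mulrCA mulrA.
by rewrite -mulr_suml (sum_embedding_dual sU) (negPf li) mul0r.
Qed.

Lemma pairing_place_diag i u v :
  pairing_V (ratM u *m P i) (ratM v *m P i) = s i (bF u v).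
Proof. by rewrite -(pairing_proj s adj_rho) -mulmxA proj_idem pairing_place. Qed.

Lemma pairing_place_cross i k x x' : i != k ->
  pairing_V (x *m P i) (x' *m P k) = 0.
Proof.
move=> ik; have [a sa] := embedding_distinct sU ik.
have := pairing_rhoC adj_rho a (x *m P i) (x' *m P k).
rewrite -!mulmxA !(proj_eigen sU) -!scalemxAr pairing_VZl pairing_VZr => /eqP.
by rewrite -subr_eq0 -mulrBl mulf_eq0 subr_eq0 (negPf sa) => /eqP.
Qed.

Lemma place_pairing_neq0 : (exists u v, bF u v != 0) ->
  forall i, exists u v, pairing_V (u *m P i) v != 0.
Proof.
move=> [u [v uv]] i; exists (ratM u), (ratM v).
by rewrite pairing_place fmorph_eq0.
Qed.

End PlaceForm.

Section SpinPlace.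
Variables (K : fieldExtType rat) (F : {subfield K}) (C : numClosedFieldType).
Variable s : 'I_(\dim {:subvs_of F}) -> {rmorphism subvs_of F -> C}.
Hypothesis sU : embedding_mx (fun i => s i) \in unitmx.
Variables (m : nat) (rho : {rmorphism subvs_of F -> 'M[rat]_(m + m)}).
Local Notation V := 'rV[rat]_(m + m).
Variable bF : V -> V -> subvs_of F.
Hypothesis hbF : is_F_pairing (fun a v => v *m rho a) bF.
Variables (VK : lmodType K) (j : {additive V -> VK}).
Hypothesis hVK : is_scalar_extension (fun a v => v *m rho a) j.
Variable bK : VK -> VK -> K.
Hypothesis hbK : is_K_pairing bF j bK.
Variables (A : falgType K) (c : {linear VK -> A}).
Hypothesis hA : is_Clifford_algebra bK c.
Variables (g0 : A).
Hypothesis hg0 : Spin c g0.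
Hypothesis g0U : g0 \is a GRing.unit.
Variables (i : 'I_(\dim {:subvs_of F})) (tau : {rmorphism K -> C}).
Hypothesis tauF : forall a, tau (vsval a) = s i a.
Local Notation P := (proj_mx_at s rho).
Local Notation ratM := (map_mx (ratr : rat -> C)).
Local Notation E := (twisted_End m tau).

(** The base change of V (x)_F K along tau, as operators on spinors. *)
Lemma place_linear_map :
  exists g : {linear VK -> E}, forall v, g (j v) = spin_op tau (ratM v *m P i).
Proof.
pose f v : E := spin_op tau (ratM v *m P i).
have fB : zmod_morphism f.
  move=> u v; apply: ev_ext => y; rewrite evD spin_opE map_mxB mulmxBl.
  rewrite -scaleN1r spin_actDl spin_actZl scaleN1r spin_opE; congr (_ + _).
  by rewrite -(spin_opE tau); symmetry; exact: opp_lfunE.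
pose fA := GRing.isZmodMorphism.Build _ _ _ fB.
pose fL : {additive V -> E} := HB.pack f fA.
case: hVK => _ /(_ E fL)[|g [gj _]]; last by exists g.
move=> a v; apply: ev_ext => y; rewrite evZ /fL /= !spin_opE tauF -spin_actZl.
rewrite map_mxM -mulmxA scalemxAr -(proj_eigen sU) (proj_commute s).
  by [].
by move=> a'; apply: rhoC_comm.
Qed.

Variable g : {linear VK -> E}.
Hypothesis gj : forall v, g (j v) = spin_op tau (ratM v *m P i).

Lemma place_clifford x y : g x * g y + g y * g x = (bK x y)%:A.
Proof.
have [bKDl bKDr bKZl bKZr bKj] := hbK.
have bK0l z : bK 0 z = 0 by rewrite -(scale0r 0) bKZl mul0r.
have bK0r z : bK z 0 = 0 by rewrite -(scale0r 0) bKZr mul0r.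
move: x; apply: (scalar_extension_ind hVK) => [|t x x' hx hx'|u].
- by rewrite linear0 mul0r mulr0 addr0 bK0l scale0r.
- rewrite linearP mulrDl mulrDr addrACA hx' -scalerAl -scalerAr -scalerDr hx.
  by rewrite bKDl bKZl scalerDl scalerA.
move: y; apply: (scalar_extension_ind hVK) => [|t x x' hx hx'|v].
- by rewrite linear0 mul0r mulr0 addr0 bK0r scale0r.
- rewrite linearP mulrDl mulrDr addrACA hx' -scalerAl -scalerAr -scalerDr hx.
  by rewrite bKDr bKZr scalerDl scalerA.
apply: ev_ext => y; rewrite !gj evD !evM !spin_opE spin_act_clifford.
have [_ _ bFZ bFtr] := hbF.
rewrite evZ ev1 bKj tauF (pairing_place_diag sU bFZ bFtr) //.
exact: (pairing_V_rho hbF).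
Qed.

Lemma place_clifford_map :
  exists G : {lrmorphism A -> E}, forall v, G (c v) = g v.
Proof.
case: hA => _ /(_ E g)[|G [Gc _]]; last by exists G.
move=> x; have := place_clifford x x; rewrite -mulr2n => h.
have two : 2%:R != 0 :> K := ext_natr_neq0 K 1.
apply: (scalerI two); rewrite scaler_nat h scalerA mulrCA divff // mulr1.
by [].
Qed.

Variable G : {lrmorphism A -> E}.
Hypothesis Gc : forall v, G (c v) = g v.

Lemma place_op_ind (Q : E -> Prop) : Q 0 ->
  (forall t f f', Q f -> Q f' -> Q (t *: f + f')) ->
  (forall v, Q (spin_op tau (ratM v *m P i))) -> forall x, Q (g x).
Proof.
move=> Q0 QD Qj; apply: (scalar_extension_ind hVK) => [|t x x' hx hx'|v].
- by rewrite linear0.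
- by rewrite linearP; apply: QD.
- by rewrite gj.
Qed.

Lemma place_even_ind (Q : E -> Prop) : Q 0 ->
  (forall t f f', Q f -> Q f' -> Q (t *: f + f')) ->
  (forall l : seq VK, ~~ odd (size l) -> Q (\prod_(x <- l) g x)) -> Q (G g0).
Proof.
move=> Q0 QD Ql; case: hg0 => + _ _.
elim/lin_span_ind => [|t x y hx hy|_ [l [lev ->]]].
- by rewrite linear0.
- by rewrite linearP; apply: QD.
rewrite rmorph_prod (eq_bigr (fun x => g x)) => [|x _]; last exact: Gc.
exact: Ql.
Qed.

(** g0 is a combination of even products of vectors. *)
Lemma spin_place_parity y : parity_supp false y -> parity_supp false (ev (G g0) y).
Proof.
move=> y0; apply: (place_even_ind (Q := fun f => parity_supp false (ev f y))) => [|t f f' hf hf' S oS|l lev].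
- by move=> S _; rewrite /ev lfunE Hstar0E.
- by rewrite evD evZ Hstar_linE hf // hf' // mulr0 addr0.
have : parity_supp (odd (size l)) (ev (\prod_(x <- l) g x) y).
  elim: l {lev} => [|x l IH]; first by rewrite big_nil ev1.
  rewrite big_cons evM /=; move: (ev _ y) IH => z hz.
  apply: (place_op_ind (Q := fun f => parity_supp (~~ odd (size l)) (ev f z))).
  - by move=> S _; rewrite /ev lfunE Hstar0E.
  - by move=> t f f' hf hf' S oS; rewrite evD evZ Hstar_linE hf // hf' // mulr0 addr0.
  - by move=> v; rewrite spin_opE; apply: spin_act_parity.
by rewrite (negPf lev).
Qed.

(** A vector of another place anticommutes with the vectors of this one, hence
    commutes with even products of them. *)
Lemma spin_place_commute (x : 'rV[C]_(m + m)) :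
  (forall v, pairing_V (ratM v *m P i) x = 0) ->
  forall y, spin_act x (ev (G g0) y) = ev (G g0) (spin_act x y).
Proof.
move=> orth; apply: (place_even_ind (Q := fun f => forall y,
  spin_act x (ev f y) = ev f (spin_act x y))) => [y|t f f' hf hf' y|l lev y].
- by rewrite /ev !lfunE linear0.
- by rewrite !evD !evZ linearP /= hf hf'.
have : spin_act x (ev (\prod_(z <- l) g z) y) =
    (-1) ^+ odd (size l) *: ev (\prod_(z <- l) g z) (spin_act x y).
  elim: l {lev} y => [|z l IH] y; first by rewrite big_nil !ev1 expr0 scale1r.
  rewrite big_cons !evM.
  have -> : spin_act x (ev (g z) (ev (\prod_(z <- l) g z) y)) =
      - ev (g z) (spin_act x (ev (\prod_(z <- l) g z) y)).
    move: (ev (\prod_(_ <- _) _) y) => {}y; move: z.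
    apply: (place_op_ind (Q := fun f => spin_act x (ev f y) = - ev f (spin_act x y))).
    - by rewrite /ev !lfunE linear0 oppr0.
    - by move=> t f f' hf hf'; rewrite !evD !evZ linearP /= hf hf' scalerN opprD.
    - by move=> v; rewrite !spin_opE spin_act_anticomm // pairing_VC.
  rewrite IH -[_ *: _]addr0 ev_linear ev0 addr0 -scaleNr /=.
  by case: (odd (size l)); rewrite /= ?expr0 ?expr1 ?opprK.
by rewrite (negPf lev) expr0 scale1r.
Qed.

Lemma spin_place_conj v v' : c v' = g0 * c v * g0^-1 ->
  g v' = G g0 * g v * G g0^-1.
Proof. by move=> e; rewrite -Gc e !rmorphM /= Gc. Qed.

Lemma spin_placeK y : ev (G g0) (ev (G g0^-1) y) = y.
Proof. by rewrite -evM -rmorphM divrr // rmorph1 ev1. Qed.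

Lemma spin_placeVK y : ev (G g0^-1) (ev (G g0) y) = y.
Proof. by rewrite -evM -rmorphM mulVr // rmorph1 ev1. Qed.

End SpinPlace.

(** * The lines ell_T are even *)

Section KilledEven.
Variables (K : fieldExtType rat) (F : {subfield K}) (C : numClosedFieldType).
Variable s : 'I_(\dim {:subvs_of F}) -> {rmorphism subvs_of F -> C}.
Hypothesis sU : embedding_mx (fun i => s i) \in unitmx.
Variables (m : nat) (rho : {rmorphism subvs_of F -> 'M[rat]_(m + m)}).
Local Notation V := 'rV[rat]_(m + m).
Variable bF : V -> V -> subvs_of F.
Hypothesis hbF : is_F_pairing (fun a v => v *m rho a) bF.
Variables (VK : lmodType K) (j : {additive V -> VK}).
Hypothesis hVK : is_scalar_extension (fun a v => v *m rho a) j.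
Variable bK : VK -> VK -> K.
Hypothesis hbK : is_K_pairing bF j bK.
Variables (A : falgType K) (c : {linear VK -> A}).
Hypothesis hA : is_Clifford_algebra bK c.
Variables (g0 : A).
Hypothesis hg0 : Spin c g0.
Variables (zeta : K) (delta : subvs_of F) (Z : 'M[rat]_(m + m)).
Hypothesis zeta0 : zeta != 0.
Hypothesis zeta2 : vsval delta = zeta ^+ 2.
Hypothesis ZZ : Z *m Z = rho delta.
Hypothesis rhoZ : forall a, rho a *m Z = Z *m rho a.
Local Notation W := (rho_image c g0 (H1dual_K j)).
Hypothesis W_rec : forall w, W w -> exists v,
  w = 2%:R^-1 *: (j v + zeta^-1 *: j (v *m Z)).
Variable tau : 'I_(\dim {:subvs_of F}) -> {rmorphism K -> C}.
Hypothesis tauF : forall i a, tau i (vsval a) = s i a.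

Local Notation P := (proj_mx_at s rho).
Local Notation ratM := (map_mx (ratr : rat -> C)).
Local Notation eigen := (eigen s rho Z).
Local Notation dualQ theta := (row_mx 0 theta : V).

(** G is the image of g0.  The first property says that G carries the dual
    vectors at the place i into the eigenspace, and comes from applying base
    change to c w = g0 (c theta) g0^-1 with w in W. *)
Lemma place_spinor i : exists G G' : Hstar m C -> Hstar m C,
  [/\ forall theta, exists2 x, eigen i (tau i zeta) x &
        forall y, spin_act x y = G (spin_act (ratM (dualQ theta) *m P i) (G' y)),
      cancel G G', cancel G' G /\ G' 0 = 0,
      forall y, parity_supp false y -> parity_supp false (G y)
    & forall x, (forall v, pairing_V (ratM v *m P i) x = 0) ->
        forall y, spin_act x (G y) = G (spin_act x y)].
Proof.
have g0U := spin_unit hg0.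
have [g gj] := place_linear_map sU hVK (tauF i).
have [G Gc] := place_clifford_map sU hbF hVK hbK hA (tauF i) gj.
exists (ev (G g0)), (ev (G g0^-1)); split.
- move=> theta; have [w rw] := rot_ex hg0 (j (dualQ theta)).
  have Ww : W w.
    by exists (j (dualQ theta)) => //; apply: lin_span_sub; exists theta.
  have [v wE] := W_rec Ww.
  have tz2 : tau i zeta ^+ 2 = s i delta by rewrite -tauF zeta2 rmorphXn.
  have tz0 : tau i zeta != 0 by rewrite (fmorph_eq0 (tau i)).
  exists (ratM v *m eigenproj s rho Z i (tau i zeta)); first by apply: (eigenproj_eigen sU ZZ rhoZ).
  move=> y; rewrite -[in RHS](spin_opE (tau i)) -gj -!evM -(spin_place_conj Gc rw).
  rewrite wE linearZ linearD linearZ /= !gj evZ evD evZ !spin_opE.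
  rewrite -spin_actZl -spin_actDl -spin_actZl; congr (spin_act _ y).
  rewrite map_mxM -(mulmxA _ _ (P i)) -(proj_ZC s rhoZ) mulmxA.
  rewrite /eigenproj mulmxA -scalemxAr mulmxDr mulmx1 -scalemxAr.
  by rewrite !fmorphV rmorph_nat.
- by move=> y; apply: spin_placeVK.
- by split=> [y|]; [apply: spin_placeK | apply: ev0].
- exact: spin_place_parity gj _ Gc.
- exact: spin_place_commute gj _ Gc.
Qed.

(** Replace y by G_i^-1 y for one place i after another: it becomes killed by
    the dual vectors of the places already treated and remains killed by the
    eigenspaces of the others, while its parity is unchanged. *)
Lemma killed_even y :
  (forall i x, eigen i (tau i zeta) x -> spin_act x y = 0) -> Hev y.
Proof.
have adj := pairing_V_rho hbF.
have /choice[GG GGP] : forall i, exists GG : (Hstar m C -> Hstar m C) * (Hstar m C -> Hstar m C),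
  [/\ forall theta, exists2 x, eigen i (tau i zeta) x &
        forall y, spin_act x y = GG.1 (spin_act (ratM (dualQ theta) *m P i) (GG.2 y)),
      cancel GG.1 GG.2, cancel GG.2 GG.1 /\ GG.2 0 = 0,
      forall y, parity_supp false y -> parity_supp false (GG.1 y)
    & forall x, (forall v, pairing_V (ratM v *m P i) x = 0) ->
        forall y, spin_act x (GG.1 y) = GG.1 (spin_act x y)].
  by move=> i; have [G [G' GP]] := place_spinor i; exists (G, G').
suff main (l : seq 'I_(\dim {:subvs_of F})) : uniq l -> forall y,
    (forall i, i \in l -> forall x, eigen i (tau i zeta) x -> spin_act x y = 0) ->
    (forall i, i \notin l -> forall theta,
      spin_act (ratM (dualQ theta) *m P i) y = 0) -> Hev y.
  move=> h; apply: (main (enum 'I_(\dim {:subvs_of F}))) => [|i _|i].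
  - exact: enum_uniq.
  - exact: h.
  - by rewrite mem_enum.
elim: l => [|i l IH] /= => [_|/andP[il ul]] {}y hl hnl.
  apply: dual_killed_even => k.
  have -> : row_mx 0 (delta_mx 0 k) = ratM (dualQ (delta_mx 0 k)).
    by rewrite map_row_mx map_mx0 map_delta_mx.
  rewrite -[X in spin_act X]mulmx1 -(sum_proj sU rho) mulmx_sumr spin_act_suml.
  by rewrite big1 // => i _; apply: hnl.
have [Gx GK [GK' G0] Gp Gcomm] := GGP i.
pose y' := (GG i).2 y.
have yE : y = (GG i).1 y' by rewrite GK'.
have pull k x : k != i -> spin_act (x *m P k) y = 0 -> spin_act (x *m P k) y' = 0.
  move=> ki; rewrite yE Gcomm => [h|v].
    by rewrite -(GK (spin_act (x *m P k) y')) h G0.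
  by apply: (pairing_place_cross sU adj); rewrite eq_sym.
have Py' : Hev y'.
  apply: (IH ul) => [k kl x ex|k kl theta].
    have ki : k != i by apply: contraNneq il => <-.
    have xP : x = x *m P k by rewrite (proj_id sU) //; case: ex.
    have kil : k \in i :: l by rewrite inE kl orbT.
    by rewrite xP; apply: pull => //; rewrite -xP; exact: hl kil x ex.
  have [->|ki] := eqVneq k i; last first.
    by apply: pull => //; apply: hnl; rewrite inE negb_or ki.
  have [x ex xE] := Gx theta.
  rewrite -(GK (spin_act _ y')) -xE (hl i) //.
  by rewrite inE eqxx.
by rewrite yE; apply/HevP; apply: Gp; apply/HevP.
Qed.

End KilledEven.

(** * Extending embeddings from F to K *)

Lemma embedding_extension (K : fieldExtType rat) (F : {subfield K})
    (iota : {rmorphism K -> K}) (zeta : K) (delta : subvs_of F) (C : fieldType)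
    (s : {rmorphism subvs_of F -> C}) (z : C) :
  (forall a, a \in F -> iota a = a) -> zeta != 0 -> iota zeta = - zeta ->
  (forall x, exists a b : subvs_of F, x = vsval a + vsval b * zeta) ->
  vsval delta = zeta ^+ 2 -> z ^+ 2 = s delta ->
  exists t : {rmorphism K -> C}, (forall a, t (vsval a) = s a) /\ t zeta = z.
Proof.
move=> iotaF zeta0 iota_zeta gen zeta2 z2.
have /choice[a /choice[b ab]] := gen.
have uniq (u v u' v' : subvs_of F) : vsval u + vsval v * zeta = vsval u' + vsval v' * zeta ->
    u = u' /\ v = v'.
  move=> e; have [|u0 v0] := zeta_indep (a := u - u') (b := v - v') iotaF zeta0 iota_zeta.
    rewrite !rmorphB /=.
    transitivity ((vsval u + vsval v * zeta) - (vsval u' + vsval v' * zeta)).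
      by ring.
    by rewrite e subrr.
  by split; apply/eqP; rewrite -subr_eq0 ?u0 ?v0.
pose t x := s (a x) + s (b x) * z.
have tE (u v : subvs_of F) : t (vsval u + vsval v * zeta) = s u + s v * z.
  by have [e1 e2] := uniq _ _ _ _ (ab (vsval u + vsval v * zeta)); rewrite /t -e1 -e2.
have tB : zmod_morphism t.
  move=> x y; rewrite {1}(ab x) {1}(ab y).
  have -> : vsval (a x) + vsval (b x) * zeta - (vsval (a y) + vsval (b y) * zeta) =
      vsval (a x - a y) + vsval (b x - b y) * zeta by rewrite !rmorphB /=; ring.
  by rewrite tE /t !rmorphB; ring.
have t1 : t 1 = 1.
  have -> : 1 = vsval (1 : subvs_of F) + vsval (0 : subvs_of F) * zeta.
    by rewrite rmorph1 rmorph0 mul0r addr0.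
  by rewrite tE rmorph1 rmorph0 mul0r addr0.
have tM : monoid_morphism t.
  split=> // x y; rewrite {1}(ab x) {1}(ab y).
  have -> : (vsval (a x) + vsval (b x) * zeta) * (vsval (a y) + vsval (b y) * zeta) =
      vsval (a x * a y + b x * b y * delta) + vsval (a x * b y + b x * a y) * zeta.
    by rewrite !rmorphD !rmorphM /= zeta2; ring.
  by rewrite tE /t !rmorphD !rmorphM -z2; ring.
pose tA := GRing.isZmodMorphism.Build _ _ _ tB.
pose tMM := GRing.isMonoidMorphism.Build _ _ _ tM.
pose tR : {rmorphism K -> C} := HB.pack t tA tMM.
exists tR; split=> [u|]; rewrite /tR /=.
  have -> : vsval u = vsval u + vsval (0 : subvs_of F) * zeta.
    by rewrite rmorph0 mul0r addr0.
  by rewrite tE rmorph0 mul0r addr0.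
have -> : zeta = vsval (0 : subvs_of F) + vsval (1 : subvs_of F) * zeta.
  by rewrite rmorph0 rmorph1 mul1r add0r.
by rewrite tE rmorph0 rmorph1 mul1r add0r.
Qed.

(** All complex embeddings of a totally real field take real values. *)
Lemma real_embeddings (R : realType) (L : fieldExtType rat) : totally_real R L ->
  exists s : 'I_(\dim {:L}) -> {rmorphism L -> R},
    embedding_mx (fun i a => (s i a)%:C%C) \in unitmx.
Proof.
move=> reL; have [s sU] := embedding_exists L R[i].
have /choice[r rE] : forall i, exists r : {rmorphism L -> R},
    forall a, (r a)%:C%C = s i a.
  move=> i; pose f a := complex.Re (s i a).
  have fE a : (f a)%:C%C = s i a.
    by have := reL (s i) a; rewrite /f; case: (s i a) => x y /= ->.
  have fB : zmod_morphism f by move=> a b; rewrite /f !raddfB.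
  have fM : monoid_morphism f.
    split=> [|a b]; apply: complexI; first by rewrite fE !rmorph1.
    by rewrite rmorphM /= !fE rmorphM.
  pose fA := GRing.isZmodMorphism.Build _ _ _ fB.
  pose fMM := GRing.isMonoidMorphism.Build _ _ _ fM.
  by exists (HB.pack f fA fMM : {rmorphism L -> R}).
exists r; rewrite (_ : embedding_mx _ = embedding_mx (fun i => s i)) //.
by apply/matrixP => i k; rewrite !mxE rE.
Qed.

(** * Descent to the rational numbers *)

Lemma Hstar_sumE (C : fieldType) m (I : finType) (y : I -> Hstar m C) S :
  (\sum_i y i) S = \sum_i y i S.
Proof. exact: sum_ffunE. Qed.

Section RationalDescent.
Variables (C : numFieldType).
Local Notation ratM := (map_mx (ratr : rat -> C)).

Definition rat_independent r (c : 'I_r -> C) : Prop :=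
  forall q : 'I_r -> rat, \sum_k c k * ratr (q k) = 0 -> forall k, q k = 0.

Lemma rat_independent_mx r (c : 'I_r -> C) p q (D : 'I_r -> 'M[rat]_(p, q)) :
  rat_independent c -> \sum_k c k *: ratM (D k) = 0 -> forall k, D k = 0.
Proof.
move=> ind D0 k; apply/matrixP => a b; rewrite [RHS]mxE.
apply: (ind (fun k => D k a b)); move/matrixP/(_ a b): D0.
rewrite summxE [RHS]mxE => e; rewrite -[RHS]e; apply: eq_bigr => l _.
by rewrite !mxE.
Qed.

Lemma rat_independent_Hstar r (c : 'I_r -> C) m (y : 'I_r -> Hstar m rat) :
  rat_independent c -> \sum_k c k *: Hstar_ratr C (y k) = 0 -> forall k, y k = 0.
Proof.
move=> ind y0 k; apply/ffunP => S; rewrite [RHS]ffunE.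
apply: (ind (fun k => y k S)); move/ffunP/(_ S): y0.
rewrite Hstar_sumE Hstar0E => e; rewrite -[RHS]e; apply: eq_bigr => l _.
by rewrite HstarZE ffunE.
Qed.

Lemma mx_rational_decomposition p q (M : 'M[C]_(p, q)) :
  exists r (c : 'I_r -> C) (N : 'I_r -> 'M[rat]_(p, q)),
    M = \sum_k c k *: ratM (N k) /\ rat_independent c.
Proof.
have [r [c [N [MN ind]]]] := rational_decomposition (fun ab : 'I_p * 'I_q => M ab.1 ab.2).
exists r, c, (fun k => \matrix_(a, b) N k (a, b)); split=> //.
apply/matrixP => a b; rewrite (MN (a, b)) summxE.
by apply: eq_bigr => k _; rewrite !mxE.
Qed.

Lemma Hstar_rational_decomposition m (y : Hstar m C) :
  exists r (c : 'I_r -> C) (u : 'I_r -> Hstar m rat),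
    y = \sum_k c k *: Hstar_ratr C (u k) /\ rat_independent c.
Proof.
have [r [c [u [yu ind]]]] := rational_decomposition (fun S => y S).
exists r, c, (fun k => [ffun S => u k S]); split=> //.
apply/ffunP => S; rewrite yu Hstar_sumE; apply: eq_bigr => k _.
by rewrite HstarZE !ffunE.
Qed.

Variables (A : Type) (m : nat) (rho : A -> 'M[rat]_(m + m)) (Z : 'M[rat]_(m + m)).
Local Notation special := (special_tensor rho Z).
Local Notation specialC := (special_tensor (fun a => ratM (rho a)) (ratM Z)).

Lemma special_tensor_ratr M : special M -> specialC (ratM M).
Proof.
move=> [Mr MZ Mt MtZ]; split=> [a||a|a].
- by rewrite map_trmx -!map_mxM Mr.
- by rewrite map_trmx -!map_mxM MZ map_mxN.
- by rewrite map_trmx -!map_mxM tensor_trace_ratr Mt rmorph0.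
- by rewrite !map_trmx -!map_mxM tensor_trace_ratr MtZ rmorph0.
Qed.

(** The defining equations are rational, so they hold for each term of a
    decomposition with independent coefficients. *)
Lemma special_tensor_components r (c : 'I_r -> C) (N : 'I_r -> 'M[rat]_(m + m)) :
  rat_independent c -> specialC (\sum_k c k *: ratM (N k)) -> forall k, special (N k).
Proof.
move=> ind [Mr MZ Mt MtZ] k.
have mulE B (D : 'I_r -> 'M[rat]_(m + m)) :
    (ratM B)^T *m (\sum_k c k *: ratM (D k)) = \sum_k c k *: ratM (B^T *m D k).
  rewrite mulmx_sumr; apply: eq_bigr => l _.
  by rewrite map_trmx -scalemxAr map_mxM.
have mulEr B : (\sum_k c k *: ratM (N k)) *m ratM B =
    \sum_k c k *: ratM (N k *m B).
  by rewrite mulmx_suml; apply: eq_bigr => l _; rewrite -scalemxAl map_mxM.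
have trE (D : 'I_r -> 'M[rat]_(m + m)) :
    tensor_trace (\sum_k c k *: ratM (D k)) = \sum_k c k * ratr (tensor_trace (D k)).
  by rewrite linear_sum; apply: eq_bigr => l _; rewrite linearZ /= tensor_trace_ratr.
split=> [a||a|a].
- apply/eqP; rewrite -subr_eq0; apply/eqP; move: k.
  apply: (rat_independent_mx (D := fun k => (rho a)^T *m N k - N k *m rho a) ind).
  under eq_bigr do rewrite map_mxB scalerBr.
  by rewrite sumrB -mulE -mulEr Mr subrr.
- apply/eqP; rewrite -subr_eq0 opprK; apply/eqP; move: k.
  apply: (rat_independent_mx (D := fun k => Z^T *m N k + N k *m Z) ind).
  under eq_bigr do rewrite map_mxD scalerDr.
  by rewrite big_split /= -mulE -mulEr MZ addNr.
- move: k; apply: (ind (fun k => tensor_trace ((rho a)^T *m N k))).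
  by rewrite -trE -mulE Mt.
- move: k; apply: (ind (fun k => tensor_trace ((rho a)^T *m (Z^T *m N k)))).
  by rewrite -trE -mulE -mulE MtZ.
Qed.

End RationalDescent.


(** * Rationality of the span *)

Theorem lemma7p1p3 (R : realType)
  (K : fieldExtType rat) (hK : CM_field R K)
  (F : {subfield K}) (hF : max_totally_real R F)
  (iota : {rmorphism K -> K}) (hiota : Gal_generator F iota)
  (d n : nat) (hd0 : (0 < d)%N) (hd : ~~ odd d)
  (hn : (4 * n = d * \dim {:K})%N)
  (X : abelian_variety R n)
  (eta_hat : {rmorphism subvs_of F -> 'M[rat]_(n.*2)})
  (eta_hat_inj : injective eta_hat)
  (eta_hat_End : forall a, End_Q X (eta_hat a))
  (bF : 'rV[rat]_(n.*2 + n.*2) -> 'rV[rat]_(n.*2 + n.*2) -> subvs_of F)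
  (hbF : is_F_pairing (fun a => act_V (eta_hat a)) bF)
  (VK : lmodType K) (j : {additive 'rV[rat]_(n.*2 + n.*2) -> VK})
  (hVK : is_scalar_extension (fun a => act_V (eta_hat a)) j)
  (bK : VK -> VK -> K) (hbK : is_K_pairing bF j bK)
  (iotaV : {additive VK -> VK}) (hiotaV : is_second_factor_action iota j iotaV)
  (A : falgType K) (c : {linear VK -> A}) (hA : is_Clifford_algebra bK c)
  (g0 : A) (hg0 : Spin c g0)
  (W : set VK) (hW : W = rho_image c g0 (H1dual_K j))
  (hWiota : W `&` (iotaV @` W) = [set 0])
  (eta : K -> 'M[rat]_(n.*2 + n.*2))
  (heta : forall (t : K) (v : 'rV[rat]_(n.*2 + n.*2)) (w : VK), W w ->
     j v = w + iotaV w -> j (v *m eta t) = t *: w + iotaV (t *: w)) :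
  exists B : {vspace Hstar n.*2 rat},
    (forall b, b \in B -> Hev b) /\
    lin_span (\bigcup_(T in @CM_type R K F) ell eta T) =
    lin_span (@Hstar_ratr n.*2 R[i] @` [set b | b \in B]).
Proof.
have iotaF := proj1 hiota.
have [zeta [zeta0 iota_zeta gen [delta zeta2]]] :=
  Gal_generator_split (CM_degree2 hK hF) hiota.
pose rho : {rmorphism subvs_of F -> 'M[rat]_(n.*2 + n.*2)} := rep_V eta_hat.
have actE : (fun a => act_V (eta_hat a)) = (fun a v => v *m rho a).
  by apply/funext => a; apply/funext => v; apply: act_VE.
rewrite actE in hbF hVK.
have bKC := bKC gen zeta2 hbF hVK hbK.
have [bKDl _ _ _ _] := hbK.
have two : 2%:R != 0 :> K := ext_natr_neq0 K 1.
have U0 : H1dual_K j 0 := lin_span0 _.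
have UD := @H1dual_linear K n.*2 VK j.
have Uiso := H1dual_isotropic hbF hbK.
have Umax := H1dual_maximal iotaF zeta0 iota_zeta gen zeta2 hbF hVK hbK.
have W0 : W 0 by rewrite hW; apply: rho_image0.
have WD t x y : W x -> W y -> W (t *: x + y) by rewrite hW; apply: rho_imageD.
have Wiso x y : W x -> W y -> bK x y = 0.
  by rewrite hW; apply: (rho_image_isotropic bKC bKDl two hA hg0 Uiso).
have Wmax x : (forall y, W y -> bK x y = 0) -> W x.
  by rewrite hW; apply: (rho_image_maximal bKC bKDl two hA hg0 Umax).

have etaF (a : subvs_of F) : eta (vsval a) = rho a.
  exact: (eta_F iotaF zeta0 iota_zeta gen zeta2 hbF hVK hbK hiotaV WD W0 Wmax hWiota heta).
have etaD := etaD iotaF zeta0 iota_zeta gen zeta2 hbF hVK hbK hiotaV WD W0 Wmax hWiota heta.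
have etaM := etaM iotaF zeta0 iota_zeta gen zeta2 hbF hVK hbK hiotaV WD W0 Wmax hWiota heta.
have eta_adj := eta_adj iotaF zeta0 iota_zeta gen zeta2 hbF hVK hbK hiotaV WD W0 Wiso Wmax hWiota heta.
have W_rec := W_recover zeta0 iota_zeta gen zeta2 hVK hiotaV heta.
pose Z := eta zeta.
have ZZ : Z *m Z = rho delta by rewrite -etaM -expr2 -zeta2 etaF.
have rhoZ a : rho a *m Z = Z *m rho a by rewrite -etaF -!etaM mulrC.
have adj_rho a u v : pairing_V (u *m rho a) v = pairing_V u (v *m rho a).
  exact: (pairing_V_rho hbF).
have adj_Z u v : pairing_V (u *m Z) v = - pairing_V u (v *m Z).
  rewrite eta_adj iota_zeta.
  have -> : - zeta = vsval (-1 : subvs_of F) * zeta by rewrite rmorphN rmorph1 mulN1r.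
  have rho1 : rho (- 1) = - 1%:M by rewrite (rmorphN rho) (rmorph1 rho).
  rewrite etaM etaF rho1 mulNmx mul1mx mulmxN.
  by rewrite -scaleN1r pairing_VZr mulN1r.
have delta0 : delta != 0.
  apply: contra_neq zeta0 => d0; apply/eqP; rewrite -sqrf_eq0 -zeta2 d0.
  by rewrite rmorph0.
have [_ _ bFZ bFtr] := hbF.
have [sR sU] := real_embeddings (proj1 hF).
pose s i : {rmorphism subvs_of F -> R[i]} := real_complex R \o sR i.
have {}sU : embedding_mx (fun i => s i) \in unitmx by exact: sU.
have n0 : (0 < n.*2)%N.
  rewrite double_gt0; have : (0 < 4 * n)%N by rewrite hn muln_gt0 hd0 (adim_gt0 {:K}%AS).
  by rewrite muln_gt0.
have bF0 : exists u v, bF u v != 0.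
  apply: contrapT => h; pose v : 'rV[rat]_(n.*2 + n.*2) := const_mx 1.
  have /rowP/(_ (lshift _ (Ordinal n0))) : v = 0.
    apply: (bF_nondeg hbF) => u; apply/eqP/negP => /negP uv.
    by apply: h; exists u, v.
  by rewrite !mxE => /eqP; rewrite oner_eq0.
have place_pairing := place_pairing_neq0 sU bFZ bFtr bF0.
pose ratM p q := @map_mx rat R[i] ratr p q.
have V_sigmaP (i : 'I_(\dim {:subvs_of F})) (t : {rmorphism K -> R[i]}) v :
    (forall a, t (vsval a) = s i a) -> V_sigma eta t v <-> eigen s rho Z i (t zeta) v.
  move=> ts; split=> [h|[hr hz] x].
    by split=> [a|]; [rewrite -ts -h /rhoC etaF | exact: h].
  have [a [b ->]] := gen x.
  rewrite etaD etaM !etaF map_mxD map_mxM mulmxDr mulmxA (hr a) (hr b) -scalemxAl hz.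
  by rewrite scalerA -scalerDl rmorphD rmorphM /= !ts.
(* The complexification of this space will be the span of the lines ell_T. *)
pose BP (b : Hstar n.*2 rat) := Hev b /\
  forall M, special_tensor rho Z M -> tensor_act M b = 0.
have BP0 : BP 0.
  split=> [S _|M _]; first exact: Hstar0E.
  by rewrite /tensor_act big1 // => k _; rewrite !linear0.
have BPD a u v : BP u -> BP v -> BP (a *: u + v).
  move=> [eu hu] [ev hv]; split=> [S oS|M sM].
    by rewrite Hstar_linE eu // ev // mulr0 addr0.
  have := tensor_act_sumr M (fun b : bool => if b then u else v) (fun b : bool => if b then a else 1).
  by rewrite !big_bool /= !scale1r hu // hv // scaler0 addr0.
have [B BE] := vspace_of_submod BP0 BPD.
exists B; split=> [b /BE[]//|].
apply/seteqP; split; apply: lin_span_min => y.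
  (* A spinor of ell_T satisfies the equations of B; so do its rational parts. *)
  move=> [T TCM ellT].
  pose tau i := T (sR i).
  have tauF i a : tau i (vsval a) = s i a by exact: TCM.
  have ky : killed s rho Z (fun i => tau i zeta) y.
    move=> i x ex; apply: ellT; apply: lin_span_sub; exists (sR i) => //.
    exact/(V_sigmaP i (tau i)).
  have evy : Hev y.
    apply: (killed_even sU hbF hVK hbK hA hg0 zeta0 zeta2 ZZ rhoZ _ tauF ky).
    by rewrite -hW.
  have w2 i : tau i zeta ^+ 2 = s i delta by rewrite -rmorphXn -zeta2 tauF.
  have [r [e [u [yE ind]]]] := Hstar_rational_decomposition y.
  exists r, e, (fun k => Hstar_ratr R[i] (u k)); split=> // k.
  exists (u k) => //; apply/BE; split=> [S oS|M sM].
    move: k; apply: (ind (fun k => u k S)).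
    have := evy S oS; rewrite yE Hstar_sumE => e0; rewrite -[RHS]e0.
    by apply: eq_bigr => k _; rewrite HstarZE ffunE.
  move: k; apply: (rat_independent_Hstar (y := fun k => tensor_act M (u k)) ind).
  have := special_kills sU delta0 ZZ rhoZ (special_tensor_ratr R[i] sM) w2 ky.
  rewrite yE tensor_act_sumr => e0; rewrite -[RHS]e0.
  by apply: eq_bigr => k _; rewrite tensor_act_ratr.
(* Complex special tensors are combinations of rational ones, so they kill the
   elements of B, and the splitting over the places applies. *)
move=> [b /BE[_ hb] <-].
have hbC M : special_tensor (rhoC R[i] rho) (ratM _ _ Z) M ->
    tensor_act M (Hstar_ratr R[i] b) = 0.
  have [r [e [N [-> ind]]]] := mx_rational_decomposition M.
  move=> /(special_tensor_components ind) sN.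
  rewrite tensor_act_suml big1 // => k _.
  rewrite tensor_actZ tensor_act_ratr hb //.
  by apply/ffunP => S; rewrite HstarZE !ffunE rmorph0 mulr0.
pose z i := sqrtC (s i delta).
have z2 i : z i ^+ 2 = s i delta by exact: sqrtCK.
have bal : balanced s rho Z z (Hstar_ratr R[i] b) by exact: special_balanced hbC.
have := balanced_span sU delta0 ZZ rhoZ adj_rho adj_Z place_pairing z2 bal.
apply: lin_span_min => {b hb hbC bal} y [w w2 kw].
(* The square roots w i define a CM-type: extend the i-th real embedding of F
   to K by sending zeta to w i. *)
have [tau tauP] := choice (fun i => embedding_extension iotaF zeta0 iota_zeta gen zeta2 (w2 i)).
have /choice[idx idxP] : forall r : {rmorphism subvs_of F -> R}, exists i,
    forall a, s i a = (r a)%:C%C.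
  move=> r; have [i iE] := embedding_complete sU (real_complex R \o r).
  by exists i => a; rewrite iE.
apply: lin_span_sub; exists (fun r => tau (idx r)) => [r a|v].
  by have [-> _] := tauP (idx r); rewrite idxP.
apply: (lin_span_ind (P := fun v => spin_act v y = 0)) => [|a x x' hx hx'|x [r _]].
- by rewrite spin_act0l.
- by rewrite spin_actDl spin_actZl hx hx' scaler0 addr0.
have [tF tz] := tauP (idx r).
by move/(V_sigmaP _ _ _ tF); rewrite tz; apply: kw.
Qed.
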